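(* Let $n\geq 2$ and for $a>0$ let $D(a)=\{z\in\mathbb{C}^n: ||z_k|^2-|z_n|^2|<(|z_n|^2+1)^{-a}\text{ for } k=1,\ldots,n-1\}$. If $\frac{2}{n-1}<a_1,a_2\leq\frac{3}{n-1}$, then every biholomorphism $F:D(a_1)\to D(a_2)$ is linear. In particular, if $D(a_1)$ and $D(a_2)$ are biholomorphically equivalent, then they are linearly equivalent. *)

(* Defs.v *)
From HB Require Import structures.
From mathcomp Require Import all_boot all_order all_algebra.
From mathcomp Require Import complex.
From mathcomp Require Import all_classical all_reals all_analysis.
Set Implicit Arguments. Unset Strict Implicit. Unset Printing Implicit Defensive.
Import Order.TTheory GRing.Theory Num.Theory.
Import numFieldNormedType.Exports.
Local Open Scope ring_scope.
Local Open Scope classical_set_scope.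

Definition sqmod (R : realType) (w : R[i]) : R :=
  complex.Re w ^+ 2 + complex.Im w ^+ 2.

(* D(a) in C^n with n = m.+1: coordinates z_1..z_{n-1} are the indices
   k != ord_max, and z_n is the coordinate ord_max. *)
Definition Dom (R : realType) (m : nat) (a : R) : set 'rV[R[i]]_m.+1 :=
  [set z | forall k : 'I_m.+1, k != ord_max ->
     `| sqmod (z ord0 k) - sqmod (z ord0 ord_max) |
       < (sqmod (z ord0 ord_max) + 1) `^ (- a)].
Arguments Dom {R} m a _.

(* holomorphic on U: complex (Frechet) differentiable at every point of U,
   the differential being C-linear since the normed spaces are over R[i] *)
Definition holomorphic_on (R : realType) (n : nat)
    (U : set 'rV[R[i]]_n) (F : 'rV[R[i]]_n -> 'rV[R[i]]_n) : Prop :=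
  forall z : ('rV[R[i]]_n : normedModType R[i]), U z -> differentiable F z.

Definition biholomorphism (R : realType) (n : nat)
    (U V : set 'rV[R[i]]_n) (F : 'rV[R[i]]_n -> 'rV[R[i]]_n) : Prop :=
  holomorphic_on U F /\
  exists G : 'rV[R[i]]_n -> 'rV[R[i]]_n,
    holomorphic_on V G /\
    (forall z, U z -> V (F z) /\ G (F z) = z) /\
    (forall w, V w -> U (G w) /\ F (G w) = w).

Definition linearly_equivalent (R : realType) (n : nat)
    (U V : set 'rV[R[i]]_n) : Prop :=
  exists A : 'M[R[i]]_n, A \in unitmx /\ (fun z => z *m A) @` U = V.

(* Main.v *)
(* The domain [D(a)] contains every complex line through the origin in a
   unimodular direction, and a function holomorphic on it is bounded on
   [D(a)], up to a constant factor, by its values on the tori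
   [|z_1| = ... = |z_n| = rho]: the homogeneous coefficients of [c |-> g (c z)]
   obey the maximum principle on a small polydisc, and homogeneity carries that
   bound to all of [D(a)].  Applied to the inverse [G], this shows that a
   biholomorphism [F] maps each of these lines properly, so the last coordinate
   of [F] on the line is an entire function tending to infinity, that is, a
   polynomial; the other coordinates are then polynomials of asymptotically the
   same modulus, hence proportional to it.  Injectivity forces degree one.  Two
   different lines meet only at the origin, which gives [F 0 = 0], so [F]
   coincides with its differential at the origin on all the tori, and by the
   torus bound on all of [D(a)]. *)

(* The torus bound replaces a power series in several variables: [D(a)] is balanced, so it is enough
   to expand along each complex line through the origin, and only one-variable integrals occur. The
   obstacle is that the homogeneous coefficients are integrals depending on the direction of the
   line. To give them a maximum principle, they are approximated by finite averages over roots of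
   unity, which are visibly holomorphic in the direction, with an error that tends to zero. The
   bounds lose constant factors, which is harmless: the torus bound serves either to get mere
   boundedness or with the bound 0. Only the maximum principle must be sharp. One-variable theory
   rests on means over circles: in logarithmic polar coordinates an annulus is a rectangle, and
   Goursat's theorem makes these means independent of the radius. For proportionality on a line,
   comparable moduli would relate only leading terms. What is used is that the difference of the
   squared moduli tends to 0, because the width allowed by [D(a)] decays as the last coordinate
   grows. *)
Require Import Defs.
From HB Require Import structures.
From mathcomp Require Import all_boot all_order all_algebra.
From mathcomp Require Import complex ring lra.
From mathcomp Require Import all_classical all_reals all_analysis.
Import Order.TTheory GRing.Theory Num.Theory.
Import numFieldNormedType.Exports.
Local Open Scope ring_scope.
Local Open Scope classical_set_scope.

Set Implicit Arguments. Unset Strict Implicit. Unset Printing Implicit Defensive.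
Local Open Scope complex_scope.

(** * Absolute value and topology of the complex numbers *)

(** With [R[i]] normed over itself, [differentiable] for functions on [R[i]] means complex
    differentiability. *)
HB.instance Definition _ (R : realType) := NormedModule.copy R[i] (R[i])^o.

(** The norm of [R[i]] takes its values in [R[i]]; a modulus with values in [R] keeps all estimates
    in an ordered field, where [lra] applies. *)
Notation nm := ComplexField.Normc.normc.

Section Norm.
Variable R : realType.
Implicit Types (x y z : R[i]).

Lemma nmE z : `|z| = (nm z)%:C. Proof. by case: z. Qed.
Lemma nm_ge0 z : 0 <= nm z. Proof. by case: z => a b; exact: sqrtr_ge0. Qed.
Lemma nm0 : nm (0 : R[i]) = 0. Proof. exact: ComplexField.Normc.normc0. Qed.
Lemma nm1 : nm (1 : R[i]) = 1. Proof. exact: ComplexField.Normc.normc1. Qed.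
Lemma nmM x y : nm (x * y) = nm x * nm y.
Proof. exact: ComplexField.Normc.normcM. Qed.
Lemma nmV x : nm x^-1 = (nm x)^-1.
Proof. exact: ComplexField.Normc.normcV. Qed.
Lemma nmN x : nm (- x) = nm x. Proof. exact: normcN. Qed.
Lemma nmD x y : nm (x + y) <= nm x + nm y. Proof. exact: le_normcD. Qed.
Lemma nmB x y : nm (x - y) <= nm x + nm y.
Proof. by rewrite -[nm y]nmN; exact: nmD. Qed.
Lemma nmBC x y : nm (x - y) = nm (y - x). Proof. by rewrite -nmN opprB. Qed.
Lemma nmX x n : nm (x ^+ n) = nm x ^+ n.
Proof. by elim: n => [|n IH]; rewrite ?expr0 ?nm1// !exprS nmM IH. Qed.
Lemma nm_eq0 x : (nm x == 0) = (x == 0).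
Proof.
apply/eqP/eqP => [/ComplexField.Normc.eq0_normc//|->]; exact: nm0.
Qed.
Lemma nm_gt0 x : (0 < nm x) = (x != 0).
Proof. by rewrite lt_neqAle nm_ge0 andbT eq_sym nm_eq0. Qed.
Lemma nm_real (t : R) : nm t%:C = `|t|.
Proof. by rewrite /= expr0n /= addr0 sqrtr_sqr. Qed.
Lemma nm_i : nm ('i : R[i]) = 1.
Proof. by rewrite /= expr0n /= add0r expr1n sqrtr1. Qed.
Lemma sqr_nm z : nm z ^+ 2 = complex.Re z ^+ 2 + complex.Im z ^+ 2.
Proof. by case: z => a b /=; rewrite sqr_sqrtr// addr_ge0 ?sqr_ge0. Qed.
Lemma ReD x y : complex.Re (x + y) = complex.Re x + complex.Re y.
Proof. by case: x y => a b [c d]. Qed.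
Lemma ImD x y : complex.Im (x + y) = complex.Im x + complex.Im y.
Proof. by case: x y => a b [c d]. Qed.
Lemma ReB x y : complex.Re (x - y) = complex.Re x - complex.Re y.
Proof. by case: x y => a b [c d]. Qed.
Lemma ImB x y : complex.Im (x - y) = complex.Im x - complex.Im y.
Proof. by case: x y => a b [c d]. Qed.
Lemma ReM x y : complex.Re (x * y) =
  complex.Re x * complex.Re y - complex.Im x * complex.Im y.
Proof. by case: x y => a b [c d]. Qed.
Lemma ImM x y : complex.Im (x * y) =
  complex.Re x * complex.Im y + complex.Im x * complex.Re y.
Proof. by case: x y => a b [c d]. Qed.
Lemma nm_ge_Re z : `|complex.Re z| <= nm z.
Proof.
rewrite -(ler_pXn2r (ltn0Sn 1)) ?nnegrE ?nm_ge0// sqr_nm real_normK ?num_real//.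
by rewrite lerDl sqr_ge0.
Qed.
Lemma nm_ge_Im z : `|complex.Im z| <= nm z.
Proof.
rewrite -(ler_pXn2r (ltn0Sn 1)) ?nnegrE ?nm_ge0// sqr_nm real_normK ?num_real//.
by rewrite lerDr sqr_ge0.
Qed.
Lemma nm_le_ReIm z : nm z <= `|complex.Re z| + `|complex.Im z|.
Proof.
rewrite {1}(complexE z); apply: (le_trans (nmD _ _)).
by rewrite nmM nm_i mul1r !nm_real.
Qed.
Lemma nm_sum (I : Type) (r : seq I) (P : pred I) (F : I -> R[i]) :
  nm (\sum_(i <- r | P i) F i) <= \sum_(i <- r | P i) nm (F i).
Proof.
elim/big_ind2: _ => [|a b c d ab cd|//]; first by rewrite nm0.
exact: le_trans (nmD _ _) (lerD ab cd).
Qed.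
Lemma nm_triangle_sub x y : nm x - nm y <= nm (x - y).
Proof. by rewrite lerBlDr -{1}[x](subrK y); exact: nmD. Qed.
Lemma nm_nat n : nm (n%:R : R[i]) = n%:R.
Proof.
have -> : (n%:R : R[i]) = (n%:R : R)%:C by rewrite rmorph_nat.
by rewrite nm_real ger0_norm.
Qed.

Lemma nbhsCP z (P : set R[i]) :
  nbhs z P <-> exists2 d : R, 0 < d & forall y, nm (y - z) < d -> P y.
Proof.
split.
  move=> /nbhs_ballP[e e0 eP].
  have er : e = (complex.Re e)%:C by rewrite RRe_real// gtr0_real.
  exists (complex.Re e); first by rewrite -ltcR -er.
  move=> y yz; apply: eP; rewrite -ball_normE /ball_ /= nmE nmBC er.
  by rewrite ltcR.
move=> [d d0 dP]; apply/nbhs_ballP; exists d%:C => /=; first by rewrite ltcR.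
by move=> y; rewrite -ball_normE /ball_ /= nmE nmBC ltcR => /dP.
Qed.

Lemma cvgCP (T : topologicalType) (f : T -> R[i]) (t : T) (l : R[i]) :
  (f x @[x --> t] --> l) <->
  forall e : R, 0 < e -> \forall x \near t, nm (f x - l) < e.
Proof.
split.
  move=> fl e e0; apply: (fl [set y | nm (y - l) < e]).
  by apply/nbhsCP; exists e.
move=> H A /nbhsCP[d d0 dA]; have := H d d0.
by apply: filterS => x /dA.
Qed.

Lemma cvgrP (T : topologicalType) (f : T -> R) (t : T) (l : R) :
  (f x @[x --> t] --> l) <->
  forall e : R, 0 < e -> \forall x \near t, `|f x - l| < e.
Proof.
split.
  move=> /cvgrPdist_lt H e /H; apply: filterS => x; by rewrite distrC.
by move=> H; apply/cvgrPdist_lt => e /H; apply: filterS => x; rewrite distrC.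
Qed.

Lemma continuous_Re : continuous (@complex.Re R).
Proof.
move=> z; apply/cvgrP => e e0; apply/nbhsCP; exists e => // y.
by apply: le_lt_trans; rewrite -ReB; exact: nm_ge_Re.
Qed.
Lemma continuous_Im : continuous (@complex.Im R).
Proof.
move=> z; apply/cvgrP => e e0; apply/nbhsCP; exists e => // y.
by apply: le_lt_trans; rewrite -ImB; exact: nm_ge_Im.
Qed.

End Norm.

(** * Complex differentiability as an epsilon-delta condition *)

Section Differentiability.
Variable R : realType.
Implicit Types (f g : R[i] -> R[i]) (z : R[i]).
Lemma differentiable_idC z : differentiable (fun w : R[i] => w) z.
Proof. by apply: ex_diff. Qed.
Lemma differentiable_expC f n z : differentiable f z ->
  differentiable (fun w => f w ^+ n) z.
Proof.
move=> df; elim: n => [|n IH].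
  rewrite (_ : (fun _ => _) = cst 1); last by apply/funext => w; rewrite expr0.
  exact: differentiable_cst.
rewrite (_ : (fun _ => _) = (fun w => f w * f w ^+ n)); last first.
  by apply/funext => w; rewrite exprS.
exact: differentiableM.
Qed.
Lemma differentiable_nmP f z : differentiable f z -> exists l : R[i],
  forall e : R, 0 < e -> exists2 d : R, 0 < d &
  forall h, nm h <= d -> nm (f (z + h) - f z - l * h) <= e * nm h.
Proof.
move=> H. move/diff_locallyP : (H) => [cd].
move=> /= E. exists ('d f z 1) => e e0.
move/eqaddoP : E => E. 
have := E (e%:C) ltac:(by rewrite ltcR).
move/nbhsCP => [d d0 dP].
exists (d/2); first by rewrite divr_gt0.
move=> h hd.
have /= := dP h.
rewrite subr0 => /(_ (le_lt_trans hd _)) => /(_ ltac:(lra)).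
rewrite !nmE -rmorphM lecR.
congr (nm _ <= _).
transitivity (f (h + z) - (f z + 'd f z h)); first by [].
rewrite [h + z]addrC opprD addrA; congr (_ - _).
rewrite -[in LHS](mulr1 h) -[h * 1]/(h *: (1 : R[i])) linearZ /=.
exact: mulrC.
Qed.

End Differentiability.

(** * Integration of complex-valued functions *)

Section ComplexIntegral.
Variable R : realType.
Let mu := @lebesgue_measure R.
Implicit Types (f g : R -> R[i]) (a b c : R).

Definition cont_on (T : topologicalType) a b (f : R -> T) :=
  forall x, a <= x <= b -> f t @[t --> x] --> f x.

Definition rint a b (u : R -> R) : R := \int[mu]_(x in `[a, b]) u x.
(** Integration by components: bounds for the two real integrals are added, which is where the
    factor 2 in [cint_bound] and everything after it comes from. *)
Definition cint a b f : R[i] :=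
  rint a b (fun t => complex.Re (f t)) +i* rint a b (fun t => complex.Im (f t)).

Lemma cont_on_integrable a b (u : R -> R) : cont_on a b u ->
  mu.-integrable `[a, b] (EFin \o u).
Proof.
move=> cu; apply: continuous_compact_integrable; first exact: segment_compact.
apply: continuous_in_subspaceT => x /set_mem /=; rewrite in_itv /= => /cu.
exact.
Qed.

Lemma cont_on_Re a b f : cont_on a b f -> cont_on a b (fun t => complex.Re (f t)).
Proof.
move=> cf x /cf fx; exact: (@continuous_cvg _ _ _ _ _ f (@complex.Re R) _ (@continuous_Re R (f x)) fx).
Qed.
Lemma cont_on_Im a b f : cont_on a b f -> cont_on a b (fun t => complex.Im (f t)).
Proof.
move=> cf x /cf fx; exact: (@continuous_cvg _ _ _ _ _ f (@complex.Im R) _ (@continuous_Im R (f x)) fx).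
Qed.

Lemma mu_itv a b : a <= b -> fine (mu `[a, b]) = b - a.
Proof.
move=> ab; rewrite /mu lebesgue_measure_itv /= lte_fin.
by case: ltgtP ab => //= -> _; rewrite subrr.
Qed.

Lemma rintD a b (u v : R -> R) : cont_on a b u -> cont_on a b v ->
  rint a b (fun t => u t + v t) = rint a b u + rint a b v.
Proof. by move=> cu cv; rewrite /rint RintegralD//; exact: cont_on_integrable. Qed.
Lemma rintB a b (u v : R -> R) : cont_on a b u -> cont_on a b v ->
  rint a b (fun t => u t - v t) = rint a b u - rint a b v.
Proof. by move=> cu cv; rewrite /rint RintegralB//; exact: cont_on_integrable. Qed.
Lemma rintZ a b k (u : R -> R) : cont_on a b u ->
  rint a b (fun t => k * u t) = k * rint a b u.
Proof. by move=> cu; rewrite /rint RintegralZl//; exact: cont_on_integrable. Qed.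
Lemma rint_cst a b k : a <= b -> rint a b (fun=> k) = k * (b - a).
Proof. by move=> ab; rewrite /rint Rintegral_cst// mu_itv. Qed.

Lemma cont_on_cst (T : topologicalType) a b (l : T) : cont_on a b (fun=> l).
Proof. by move=> x _; exact: cvg_cst. Qed.

Lemma rint_bound a b (u : R -> R) B : a <= b -> cont_on a b u ->
  (forall x, a <= x <= b -> `|u x| <= B) -> `|rint a b u| <= B * (b - a).
Proof.
move=> ab cu uB; rewrite ler_norml; apply/andP; split.
  rewrite -mulNr -rint_cst//; apply: le_Rintegral => //.
  - by apply: cont_on_integrable; exact: cont_on_cst.
  - exact: cont_on_integrable.
  - by move=> x /=; rewrite in_itv /= => /uB; rewrite ler_norml => /andP[].
rewrite -rint_cst//; apply: le_Rintegral => //.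
- exact: cont_on_integrable.
- by apply: cont_on_integrable; exact: cont_on_cst.
- by move=> x /=; rewrite in_itv /= => /uB; rewrite ler_norml => /andP[].
Qed.

Lemma rint_cat a b c (u : R -> R) : a <= b -> b <= c -> cont_on a c u ->
  rint a c u = rint a b u + rint b c u.
Proof.
move=> ab bc cu; have iu := cont_on_integrable cu.
have /= := @Rintegral_itvB R u (BLeft a) (BRight c) b iu.
rewrite !bnd_simp => /(_ ab bc) E.
rewrite /rint -(@Rintegral_itv_obnd_cbnd R b (BRight c)); last first.
  by apply: integrableS iu => //; apply: subset_itvr; rewrite bnd_simp.
by rewrite -E addrC subrK.
Qed.

Lemma eq_cint a b f g : (forall x, a <= x <= b -> f x = g x) ->
  cint a b f = cint a b g.
Proof.
move=> fg; rewrite /cint /rint; congr (_ +i* _); apply: eq_Rintegral => x.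
  by rewrite inE /= in_itv /= => /fg ->.
by rewrite inE /= in_itv /= => /fg ->.
Qed.

Lemma cintD a b f g : cont_on a b f -> cont_on a b g ->
  cint a b (fun t => f t + g t) = cint a b f + cint a b g.
Proof.
move=> cf cg; rewrite /cint -[RHS]/(_ +i* _); congr (_ +i* _).
  rewrite -rintD; [|exact: cont_on_Re|exact: cont_on_Re].
  by congr rint; apply/funext => t; rewrite ReD.
rewrite -rintD; [|exact: cont_on_Im|exact: cont_on_Im].
by congr rint; apply/funext => t; rewrite ImD.
Qed.

Lemma cintZ a b k f : cont_on a b f ->
  cint a b (fun t => k * f t) = k * cint a b f.
Proof.
move=> cf; have cr := cont_on_Re cf; have ci := cont_on_Im cf.
have cZ l (u : R -> R) : cont_on a b u -> cont_on a b (fun t => l * u t).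
  by move=> cu x /cu ux; apply: cvgM; [exact: cvg_cst|exact: ux].
rewrite /cint {3}(_ : k = complex.Re k +i* complex.Im k); last by case: (k).
rewrite -[RHS]/(_ +i* _) -!rintZ//; congr (_ +i* _).
  rewrite -rintB; [|exact: cZ|exact: cZ].
  by congr rint; apply/funext => t; rewrite ReM.
rewrite -rintD; [|exact: cZ|exact: cZ].
by congr rint; apply/funext => t; rewrite ImM.
Qed.

Lemma cont_onN a b f : cont_on a b f -> cont_on a b (fun t => - f t).
Proof.
move=> cf x /cf fx; apply/cvgCP => e e0.
have /cvgCP/(_ e e0) := fx; apply: filterS => y.
by rewrite -opprD nmN.
Qed.
Lemma cont_onD a b f g : cont_on a b f -> cont_on a b g ->
  cont_on a b (fun t => f t + g t).
Proof.
move=> cf cg x xab; apply/cvgCP => e e0.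
have e2 : 0 < e / 2 by rewrite divr_gt0.
have /cvgCP/(_ _ e2) Hf := cf x xab; have /cvgCP/(_ _ e2) Hg := cg x xab.
apply: filterS2 Hf Hg => y fy gy.
rewrite opprD addrACA; apply: (le_lt_trans (nmD _ _)); lra.
Qed.
Lemma cont_onB a b f g : cont_on a b f -> cont_on a b g ->
  cont_on a b (fun t => f t - g t).
Proof. by move=> cf cg; exact: (cont_onD cf (cont_onN cg)). Qed.

Lemma cintB a b f g : cont_on a b f -> cont_on a b g ->
  cint a b (fun t => f t - g t) = cint a b f - cint a b g.
Proof.
move=> cf cg; have E : cint a b (fun t => - g t) = - cint a b g.
  transitivity (cint a b (fun t => (- 1 : R[i]) * g t)).
    by apply: eq_cint => t _; rewrite mulN1r.
  by rewrite (cintZ _ cg) mulN1r.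
by rewrite -E; exact: (cintD cf (cont_onN cg)).
Qed.

Lemma cint_cst a b k : a <= b -> cint a b (fun=> k) = k * (b - a)%:C.
Proof.
move=> ab; rewrite /cint !rint_cst//; case: k => u v /=.
by simpc.
Qed.

Lemma cint_cat a b c f : a <= b -> b <= c -> cont_on a c f ->
  cint a c f = cint a b f + cint b c f.
Proof.
move=> ab bc cf; rewrite /cint (rint_cat ab bc (cont_on_Re cf)).
by rewrite (rint_cat ab bc (cont_on_Im cf)).
Qed.

Lemma cint_bound a b f B : a <= b -> cont_on a b f ->
  (forall x, a <= x <= b -> nm (f x) <= B) -> nm (cint a b f) <= 2 * B * (b - a).
Proof.
move=> ab cf fB; apply: (le_trans (nm_le_ReIm _)).
rewrite -mulrA mulr_natl mulr2n; apply: lerD; apply: rint_bound => //.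
- exact: cont_on_Re.
- by move=> x /fB; apply: le_trans; exact: nm_ge_Re.
- exact: cont_on_Im.
- by move=> x /fB; apply: le_trans; exact: nm_ge_Im.
Qed.

End ComplexIntegral.

(** * Goursat's theorem on rectangles *)

Section Goursat.
Variable R : realType.
Implicit Types (h : R -> R -> R[i]) (x y : R).

(** Complex differentiability in real coordinates, so that a function can be pulled back by polar
    coordinates; the box-shaped neighbourhood and the sum of the two displacements fit
    rectangles. *)
Definition hol_at h x y := exists l : R[i], forall e, 0 < e ->
  exists2 d : R, 0 < d & forall x' y', `|x' - x| <= d -> `|y' - y| <= d ->
    nm (h x' y' - h x y - l * ((x' - x) +i* (y' - y)))
      <= e * (`|x' - x| + `|y' - y|).

(** The contour integral of [h] dz counterclockwise around the rectangle, with opposite sides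
    paired. *)
Definition bd_int h x0 x1 y0 y1 : R[i] :=
  cint x0 x1 (fun t => h t y0 - h t y1) +
  'i * cint y0 y1 (fun t => h x1 t - h x0 t).

Lemma hol_at_near h x y : hol_at h x y -> forall e, 0 < e ->
  exists2 d : R, 0 < d & forall x' y', `|x' - x| <= d -> `|y' - y| <= d ->
    nm (h x' y' - h x y) < e.
Proof.
move=> [l hl] e e0; have [d d0 dP] := hl 1 ltr01.
have k0 : 0 < 2 * (nm l + 2) by have := nm_ge0 l; lra.
exists (Num.min d (e / (2 * (nm l + 2)))).
  by rewrite lt_min d0 divr_gt0.
move=> x' y'; rewrite !le_min => /andP[xd xe] /andP[yd ye].
have := dP _ _ xd yd; rewrite mul1r => H.
have nle : nm ((x' - x) +i* (y' - y)) <= `|x' - x| + `|y' - y|.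
  exact: nm_le_ReIm.
have hh : h x' y' - h x y = (h x' y' - h x y - l * ((x' - x) +i* (y' - y)))
    + l * ((x' - x) +i* (y' - y)) by rewrite subrK.
rewrite hh; apply: (le_lt_trans (nmD _ _)); rewrite nmM.
have s0 : `|x' - x| + `|y' - y| <= 2 * (e / (2 * (nm l + 2))) by lra.
have ml : nm l * nm ((x' - x) +i* (y' - y)) <= nm l * (`|x' - x| + `|y' - y|).
  by rewrite ler_wpM2l// nm_ge0.
have ee : (nm l + 1) * (2 * (e / (2 * (nm l + 2)))) < e.
  have n0 := nm_ge0 l; move: (nm l) n0 => u n0.
  have -> : (u + 1) * (2 * (e / (2 * (u + 2)))) = e * ((u + 1) / (u + 2)).
    by field; lra.
  by rewrite gtr_pMr// ltr_pdivrMr; lra.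
have n0 := nm_ge0 l.
have : (nm l + 1) * (`|x' - x| + `|y' - y|) <= (nm l + 1) * (2 * (e / (2 * (nm l + 2)))).
  by rewrite ler_wpM2l//; lra.
lra.
Qed.

Lemma hol_at_contx h x y : hol_at h x y -> h t y @[t --> x] --> h x y.
Proof.
move=> hh; apply/cvgCP => e /(hol_at_near hh)[d d0 dP].
near=> t; apply: dP; last by rewrite subrr normr0 ltW.
rewrite distrC; near: t.
by have /cvgrPdist_le/(_ d d0) := @cvg_id _ (nbhs x).
Unshelve. all: by end_near. Qed.

Lemma hol_at_conty h x y : hol_at h x y -> h x t @[t --> y] --> h x y.
Proof.
move=> hh; apply/cvgCP => e /(hol_at_near hh)[d d0 dP].
near=> t; apply: dP; first by rewrite subrr normr0 ltW.
rewrite distrC; near: t.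
by have /cvgrPdist_le/(_ d d0) := @cvg_id _ (nbhs y).
Unshelve. all: by end_near. Qed.

Definition hol_rect h x0 x1 y0 y1 :=
  forall x y, x0 <= x <= x1 -> y0 <= y <= y1 -> hol_at h x y.

Lemma hol_rect_contx h x0 x1 y0 y1 y : hol_rect h x0 x1 y0 y1 ->
  y0 <= y <= y1 -> cont_on x0 x1 (h^~ y).
Proof. by move=> hh yy x xx; apply: hol_at_contx; exact: hh. Qed.

Lemma hol_rect_conty h x0 x1 y0 y1 x : hol_rect h x0 x1 y0 y1 ->
  x0 <= x <= x1 -> cont_on y0 y1 (h x).
Proof. by move=> hh xx y yy; apply: hol_at_conty; exact: hh. Qed.

Lemma bd_int_catx h x0 xm x1 y0 y1 : x0 <= xm -> xm <= x1 -> y0 <= y1 ->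
  hol_rect h x0 x1 y0 y1 ->
  bd_int h x0 x1 y0 y1 = bd_int h x0 xm y0 y1 + bd_int h xm x1 y0 y1.
Proof.
move=> a b c hh; rewrite /bd_int (cint_cat a b); last first.
  by apply: cont_onB; apply: (hol_rect_contx hh); rewrite lexx c.
have cy x : x0 <= x <= x1 -> cont_on y0 y1 (h x).
  by move=> xx; exact: (hol_rect_conty hh).
have [c0 c1 cm] : [/\ cont_on y0 y1 (h x0), cont_on y0 y1 (h x1) &
    cont_on y0 y1 (h xm)] by split; apply: cy; rewrite ?lexx ?a ?b ?(le_trans a b).
rewrite (cintB c1 c0) (cintB cm c0) (cintB c1 cm); ring.
Qed.

Lemma bd_int_caty h x0 x1 y0 ym y1 : x0 <= x1 -> y0 <= ym -> ym <= y1 ->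
  hol_rect h x0 x1 y0 y1 ->
  bd_int h x0 x1 y0 y1 = bd_int h x0 x1 y0 ym + bd_int h x0 x1 ym y1.
Proof.
move=> c a b hh; rewrite /bd_int (cint_cat a b); last first.
  by apply: cont_onB; apply: (hol_rect_conty hh); rewrite lexx c.
have cy y : y0 <= y <= y1 -> cont_on x0 x1 (h^~ y).
  by move=> yy; exact: (hol_rect_contx hh).
have [c0 c1 cm] : [/\ cont_on x0 x1 (h^~ y0), cont_on x0 x1 (h^~ y1) &
    cont_on x0 x1 (h^~ ym)] by split; apply: cy; rewrite ?lexx ?a ?b ?(le_trans a b).
rewrite (cintB c0 c1) (cintB c0 cm) (cintB cm c1); ring.
Qed.

(** The affine part of [h] contributes nothing to the contour integral. The remainder is at most
    [e / 4 * s] at each point, two points are paired in each integrand, and [cint_bound] doubles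
    again. *)
Lemma bd_int_local h x y : hol_at h x y -> forall e, 0 < e ->
  exists2 d : R, 0 < d & forall x0 x1 y0 y1, hol_rect h x0 x1 y0 y1 ->
    x0 <= x <= x1 -> y0 <= y <= y1 -> x1 - x0 <= d -> y1 - y0 <= d ->
    nm (bd_int h x0 x1 y0 y1) <= e * ((x1 - x0) + (y1 - y0)) ^+ 2.
Proof.
move=> [l hl] e e0; have [d d0 dP] := hl (e / 4) ltac:(lra).
exists d => // x0 x1 y0 y1 hh /andP[xx0 xx1] /andP[yy0 yy1] xd yd.
set s := (x1 - x0) + (y1 - y0).
have rem x' y' : x0 <= x' <= x1 -> y0 <= y' <= y1 ->
    nm (h x' y' - h x y - l * ((x' - x) +i* (y' - y))) <= e / 4 * s.
  move=> /andP[x'0 x'1] /andP[y'0 y'1].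
  have ax : `|x' - x| <= x1 - x0 by rewrite ler_norml; lra.
  have ay : `|y' - y| <= y1 - y0 by rewrite ler_norml; lra.
  apply: (le_trans (dP _ _ _ _)); [lra|lra|].
  by rewrite ler_wpM2l//; rewrite /s; lra.
have x01 : x0 <= x1 by lra.
have y01 : y0 <= y1 by lra.
have Ix : nm (cint x0 x1 (fun t => h t y0 - h t y1)
              - l * (0 +i* (y0 - y1)) * (x1 - x0)%:C)
    <= 2 * (2 * (e / 4 * s)) * (x1 - x0).
  have cx : cont_on x0 x1 (fun t => h t y0 - h t y1).
    by apply: cont_onB; apply: (hol_rect_contx hh); rewrite lexx y01.
  rewrite -cint_cst// -(cintB cx (@cont_on_cst R _ _ _ _)).
  apply: (cint_bound x01 (cont_onB cx (@cont_on_cst R _ _ _ _))).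
  move=> t tx.
  have -> : h t y0 - h t y1 - l * (0 +i* (y0 - y1)) =
    (h t y0 - h x y - l * ((t - x) +i* (y0 - y))) -
    (h t y1 - h x y - l * ((t - x) +i* (y1 - y))).
    have -> : 0 +i* (y0 - y1) = ((t - x) +i* (y0 - y)) - ((t - x) +i* (y1 - y)).
      by simpc; congr (_ +i* _); lra.
    ring.
  apply: (le_trans (nmB _ _)).
  have := rem _ y0 tx; have := rem _ y1 tx; rewrite !lexx y01 => /(_ isT) + /(_ isT).
  lra.
have Iy : nm (cint y0 y1 (fun t => h x1 t - h x0 t)
              - l * (x1 - x0)%:C * (y1 - y0)%:C)
    <= 2 * (2 * (e / 4 * s)) * (y1 - y0).
  have cy : cont_on y0 y1 (fun t => h x1 t - h x0 t).
    by apply: cont_onB; apply: (hol_rect_conty hh); rewrite lexx x01.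
  rewrite -cint_cst// -(cintB cy (@cont_on_cst R _ _ _ _)).
  apply: (cint_bound y01 (cont_onB cy (@cont_on_cst R _ _ _ _))).
  move=> t ty.
  have -> : h x1 t - h x0 t - l * (x1 - x0)%:C =
    (h x1 t - h x y - l * ((x1 - x) +i* (t - y))) -
    (h x0 t - h x y - l * ((x0 - x) +i* (t - y))).
    have -> : (x1 - x0)%:C = ((x1 - x) +i* (t - y)) - ((x0 - x) +i* (t - y)).
      by simpc; congr (_ +i* _); lra.
    ring.
  apply: (le_trans (nmB _ _)).
  have := rem x1 _ _ ty; have := rem x0 _ _ ty; rewrite !lexx x01 => /(_ isT) + /(_ isT).
  lra.
rewrite /bd_int.
set A := cint x0 x1 _ in Ix *; set B := cint y0 y1 _ in Iy *.
(* The two subtracted terms are the contributions of the linear part to the two pairs of sides; they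
   cancel because the square of ['i] is -1. *)
have -> : A + 'i * B = (A - l * (0 +i* (y0 - y1)) * (x1 - x0)%:C) +
    'i * (B - l * (x1 - x0)%:C * (y1 - y0)%:C).
  have -> : 0 +i* (y0 - y1) = - 'i * (y1 - y0)%:C :> R[i].
    by simpc; congr (_ +i* _); lra.
  ring.
apply: (le_trans (nmD _ _)); rewrite nmM nm_i mul1r.
rewrite (_ : e * s ^+ 2 = 2 * (2 * (e / 4 * s)) * (x1 - x0) +
  2 * (2 * (e / 4 * s)) * (y1 - y0)); first by lra.
by rewrite /s; field.
Qed.

Lemma nested_intervals (a b : nat -> R) : (forall k, a k <= a k.+1) ->
  (forall k, b k.+1 <= b k) -> (forall k, a k <= b k) ->
  exists x, forall k, a k <= x <= b k.
Proof.
move=> ia ib ab.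
have ha : {homo a : i j / (i <= j)%N >-> i <= j}.
  by apply: homo_leq => //; exact: le_trans.
have hb : {homo b : i j / (i <= j)%N >-> j <= i}.
  apply: (@homo_leq _ b (fun x y => y <= x)) => //.
  by move=> y x z xy yz; exact: le_trans yz xy.
have ub j : ubound (range a) (b j).
  move=> _ [i _ <-]; apply: (le_trans (ha _ _ (leq_maxl i j))).
  exact: le_trans (ab _) (hb _ _ (leq_maxr i j)).
exists (sup (range a)) => k; apply/andP; split.
  by apply: ub_le_sup; [exists (b 0%N); exact: ub|exists k].
by apply: ge_sup; [exists (a 0%N), 0%N|exact: ub].
Qed.

(** Pigeonhole on the four quarters. The sides are written as sums of halves, so that the quarters
    have sides exactly [w] and [v]. *)
Lemma bd_int_quarter h x y w v t : 0 <= w -> 0 <= v ->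
  hol_rect h x (x + w + w) y (y + v + v) ->
  4 * t < nm (bd_int h x (x + w + w) y (y + v + v)) ->
  exists x' y', [/\ x' = x \/ x' = x + w, y' = y \/ y' = y + v &
    t < nm (bd_int h x' (x' + w) y' (y' + v))].
Proof.
move=> w0 v0 hh.
have xw : x <= x + w by rewrite lerDl.
have xww : x + w <= x + w + w by rewrite lerDl.
have yv : y <= y + v by rewrite lerDl.
have yvv : y + v <= y + v + v by rewrite lerDl.
have yy := le_trans yv yvv.
rewrite (bd_int_catx xw xww yy hh).
rewrite (bd_int_caty xw yv yvv); last first.
  by move=> a b /andP[xa ax] bb; apply: hh => //; rewrite xa (le_trans ax xww).
rewrite (bd_int_caty xww yv yvv); last first.
  by move=> a b /andP[xa ax] bb; apply: hh => //; rewrite ax (le_trans xw xa).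
have [tA _|At] := ltP t (nm (bd_int h x (x + w) y (y + v))).
  by exists x, y; split=> //; left.
have [tB _|Bt] := ltP t (nm (bd_int h x (x + w) (y + v) (y + v + v))).
  by exists x, (y + v); split=> //; [left|right].
have [tC _|Ct] := ltP t (nm (bd_int h (x + w) (x + w + w) y (y + v))).
  by exists (x + w), y; split=> //; [right|left].
have [tD _|Dt] := ltP t (nm (bd_int h (x + w) (x + w + w) (y + v) (y + v + v))).
  by exists (x + w), (y + v); split=> //; right.
move=> /lt_le_trans/(_ (le_trans (nmD _ _) (lerD (nmD _ _) (nmD _ _)))).
move: (nm _) (nm _) (nm _) (nm _) At Bt Ct Dt => {}A {}B {}C {}D.
by move=> *; exfalso; lra.
Qed.

Theorem goursat h X0 X1 Y0 Y1 : X0 <= X1 -> Y0 <= Y1 ->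
  hol_rect h X0 X1 Y0 Y1 -> bd_int h X0 X1 Y0 Y1 = 0.
Proof.
move=> X01 Y01 hh.
pose w (k : nat) := (X1 - X0) / 2 ^+ k; pose v (k : nat) := (Y1 - Y0) / 2 ^+ k.
have wS k : w k = w k.+1 + w k.+1.
  by rewrite /w exprS; field; rewrite expf_neq0.
have vS k : v k = v k.+1 + v k.+1.
  by rewrite /v exprS; field; rewrite expf_neq0.
have w0 k : 0 <= w k by rewrite divr_ge0 ?exprn_ge0//; lra.
have v0 k : 0 <= v k by rewrite divr_ge0 ?exprn_ge0//; lra.
suff H e : 0 < e -> nm (bd_int h X0 X1 Y0 Y1) <= e * ((X1 - X0) + (Y1 - Y0)) ^+ 2.
  apply/eqP; rewrite -nm_eq0 eq_le nm_ge0 andbT; apply/ler_addgt0Pr => e e0.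
  rewrite add0r; set s := (X1 - X0) + (Y1 - Y0) in H.
  have s0 : 0 <= s by rewrite /s; lra.
  have q0 : 0 < s ^+ 2 + 1 by rewrite ltr_wpDl ?sqr_ge0.
  apply: le_trans (H (e / (s ^+ 2 + 1)) _) _; first by rewrite divr_gt0.
  rewrite mulrAC ler_pdivrMr// ler_wpM2l ?ltW//; lra.
move=> e0; rewrite leNgt; apply/negP => bad0.
(* [p] is the lower left corner of a rectangle of the k-th generation. Badness is inherited by some
   quarter because the threshold, quadratic in the sides, is divided by 4 as well. *)
pose bad (k : nat) (p : R * R) := [/\ X0 <= p.1, p.1 + w k <= X1,
  Y0 <= p.2, p.2 + v k <= Y1 &
  e * (w k + v k) ^+ 2 < nm (bd_int h p.1 (p.1 + w k) p.2 (p.2 + v k))].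
pose nxt (k : nat) (p q : R * R) := [/\ bad k.+1 q, p.1 <= q.1,
  q.1 + w k.+1 <= p.1 + w k, p.2 <= q.2 & q.2 + v k.+1 <= p.2 + v k].
have step k p : bad k p -> exists q, nxt k p q.
  move=> [a b c d N].
  have wk := w0 k.+1; have vk := v0 k.+1; have wS' := wS k; have vS' := vS k.
  have ex : p.1 + w k = p.1 + w k.+1 + w k.+1 by rewrite wS' addrA.
  have ey : p.2 + v k = p.2 + v k.+1 + v k.+1 by rewrite vS' addrA.
  have E : e * (w k + v k) ^+ 2 = 4 * (e * (w k.+1 + v k.+1) ^+ 2).
    by rewrite wS' vS'; ring.
  rewrite /nxt /bad; rewrite E ex ey in N b d *.
  have {E wS' vS' ex ey} [|x' [y' [x'E y'E N']]] := bd_int_quarter wk vk _ N.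
    move=> x y /andP[x1 x2] /andP[y1 y2]; apply: hh; apply/andP; split.
    - exact: le_trans a x1.
    - exact: le_trans x2 b.
    - exact: le_trans c y1.
    - exact: le_trans y2 d.
  move: (w k.+1) (v k.+1) wk vk b d x'E y'E N' => u z u0 z0 b d x'E y'E N'.
  exists (x', y') => /=; split.
  - by clear -a b c d u0 z0 x'E y'E N'; case: x'E => xE; case: y'E => yE; split=> //=; lra.
  - by case: x'E => ->; lra.
  - by case: x'E => ->; lra.
  - by case: y'E => ->; lra.
  - by case: y'E => ->; lra.
(* The default value of [xget] is never taken: by [step] a bad rectangle always has a bad
   quarter. *)
pose f := fix f (k : nat) : R * R :=
  if k is j.+1 then xget (f j) [set q | nxt j (f j) q] else (X0, Y0).
have fb k : bad k (f k).
  elim: k => [|k IH].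
    have -> : f 0%N = (X0, Y0) by [].
    have eX : X0 + w 0%N = X1 by rewrite /w expr0 divr1 addrC subrK.
    have eY : Y0 + v 0%N = Y1 by rewrite /v expr0 divr1 addrC subrK.
    by split; rewrite /= ?eX ?eY// /w /v expr0 !divr1.
  by have [] := xgetPex (f k) (step _ _ IH).
have fn k : nxt k (f k) (f k.+1) by exact: (xgetPex (f k) (step _ _ (fb k))).
have [x xP] : exists x, forall k, (f k).1 <= x <= (f k).1 + w k.
  apply: nested_intervals => k; first by case: (fn k).
    by case: (fn k).
  by rewrite lerDl.
have [y yP] : exists y, forall k, (f k).2 <= y <= (f k).2 + v k.
  apply: nested_intervals => k; first by case: (fn k).
    by case: (fn k).
  by rewrite lerDl.
have hxy : hol_at h x y.
  apply: hh; first by have := xP 0%N; rewrite /= /w expr0 divr1; lra.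
  by have := yP 0%N; rewrite /= /v expr0 divr1; lra.
(* The rectangles shrink to [(x, y)]; once they are small, the local estimate there contradicts
   badness. *)
have [d d0 dP] := bd_int_local hxy e0.
have [k kP] : exists k : nat, (w k <= d) && (v k <= d).
  pose M := (X1 - X0) + (Y1 - Y0).
  have [n nP] : exists n : nat, M / d <= 2 ^+ n.
    exists (Num.truncn (M / d)).+1; apply: ltW.
    apply: (lt_trans (truncnS_gt _)).
    by rewrite -natrX ltr_nat; exact: ltn_expl.
  move: nP; rewrite ler_pdivrMr// => nP.
  exists n; rewrite /w /v !ler_pdivrMr ?exprn_gt0//; rewrite ![d * _]mulrC.
  by apply/andP; split; apply: le_trans nP; rewrite /M; lra.
case/andP: kP => wd vd.
have [a b c g N] := fb k.
have := dP (f k).1 ((f k).1 + w k) (f k).2 ((f k).2 + v k) _ (xP k) (yP k).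
rewrite ![_ + _ - _]addrAC !subrr !add0r => /(_ _ wd vd) L.
move: N; rewrite ltNge => /negP; apply; apply: L => x' y' /andP[? ?] /andP[? ?].
by apply: hh; lra.
Qed.

End Goursat.

(** * Means over circles *)

Section CircleMean.
Variable R : realType.
Implicit Types (f g : R[i] -> R[i]) (z : R[i]) (r s t : R).

Definition cdiff f z := exists l : R[i],
  forall e : R, 0 < e -> exists2 d : R, 0 < d &
  forall h, nm h <= d -> nm (f (z + h) - f z - l * h) <= e * nm h.

Definition cis t : R[i] := cos t +i* sin t.
(** The complex exponential of x + iy, which maps a rectangle of height [tau] onto an annulus. *)
Definition polar (x y : R) : R[i] := (expR x)%:C * cis y.

Lemma nm_cis t : nm (cis t) = 1.
Proof. by rewrite /= cos2Dsin2 sqrtr1. Qed.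
Lemma nm_rcis r t : nm (r%:C * cis t) = `|r|.
Proof. by rewrite nmM nm_cis mulr1 nm_real. Qed.
Lemma nm_polar x y : nm (polar x y) = expR x.
Proof. by rewrite nm_rcis ger0_norm ?expR_ge0. Qed.
Lemma cisD s t : cis (s + t) = cis s * cis t.
Proof. by rewrite /cis cosD sinD; simpc; rewrite [sin s * _ + _]addrC. Qed.
Lemma polarD x y s t : polar (x + s) (y + t) = polar x y * polar s t.
Proof. by rewrite /polar cisD expRD rmorphM /=; ring. Qed.

Lemma is_derive_le (u : R -> R) (l : R) : is_derive (0 : R) (1 : R) u l ->
  forall e, 0 < e -> exists2 d : R, 0 < d &
    forall h, `|h| <= d -> `|u h - u 0 - l * h| <= e * `|h|.
Proof.
move=> du e e0.
have [dv dl] := du.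
have /cvgrPdist_le/(_ e e0) : h^-1 *: (u (h *: 1 + 0) - u 0) @[h --> 0^'] --> l.
  by rewrite -dl; exact: dv.
move=> /nbhs_ballP[d /= d0 dP]; exists (d / 2); first by rewrite divr_gt0.
move=> h hd; have [->|h0] := eqVneq h 0.
  by rewrite subrr normr0 mulr0 mulr0 subr0 normr0.
have := dP h; rewrite -ball_normE /= sub0r normrN => /(_ _ h0).
move=> /(_ (le_lt_trans hd _)) => /(_ ltac:(lra)).
rewrite addr0 -[h *: 1]/(h * 1) mulr1 -[_ *: _]/(_ * _) => H.
have -> : u h - u 0 - l * h = - (h * (l - h^-1 * (u h - u 0))).
  by field.
by rewrite normrN normrM mulrC ler_wpM2r.
Qed.

(** The exponential has derivative 1 at the origin; [polarD] transports this to every other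
    point. *)
Lemma polar_diff0 e : 0 < e -> exists2 d : R, 0 < d &
  forall s t, `|s| <= d -> `|t| <= d ->
    nm (polar s t - 1 - (s +i* t)) <= e * (`|s| + `|t|).
Proof.
move=> e0.
have [d1 d10 H1] := is_derive_le (is_derive_expR 0) ltr01.
(* Since [expR s <= 3] for [s <= 1], the errors add up to [e / 8] times [s] plus (3 + 3 + 2) [e / 8]
   times [t], in absolute values. *)
have e4 : 0 < e / 8 by lra.
have [d2 d20 H2] := is_derive_le (is_derive_expR 0) e4.
have [d3 d30 H3] := is_derive_le (is_derive_cos 0) e4.
have [d4 d40 H4] := is_derive_le (is_derive_sin 0) e4.
pose d5 := Num.min 1 (e / 8).
have d50 : 0 < d5 by rewrite lt_min ltr01.
exists (Num.min (Num.min d1 d2) (Num.min (Num.min d3 d4) d5)).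
  by rewrite !lt_min d10 d20 d30 d40 ltr01.
move=> s t; rewrite !le_min => /andP[/andP[s1 s2] /andP[_ /andP[s3 s4]]].
move=> /andP[_ /andP[/andP[t3 t4] _]].
have := H1 s s1; have := H2 s s2; have := H3 t t3; have := H4 t t4.
rewrite expR0 cos0 sin0 oppr0 mul0r !subr0 ?addr0 !mul1r => Ht Hc Hs2 Hs1.
have nx : `|expR s - 1| <= 2 * `|s|.
  rewrite -[expR s - 1](subrK s); apply: (le_trans (ler_normD _ _)).
  by move: `|s| Hs1 => a; lra.
have ex0 := expR_ge0 s.
have ex3 : expR s <= 3 by move: nx; rewrite ler_norml; move: (`|s|) s3 => a; lra.
have -> : polar s t - 1 - (s +i* t) =
   (expR s * cos t - 1 - s) +i* (expR s * sin t - t).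
  by rewrite /polar /cis -[1 in LHS]/(1 +i* 0); simpc; rewrite ?addrA.
apply: (le_trans (nm_le_ReIm _)) => /=.
have -> : expR s * cos t - 1 - s = (expR s - 1 - s) + expR s * (cos t - 1) by ring.
have -> : expR s * sin t - t = expR s * (sin t - t) + (expR s - 1) * t by ring.
have := ler_normD (expR s - 1 - s) (expR s * (cos t - 1)).
have := ler_normD (expR s * (sin t - t)) ((expR s - 1) * t).
rewrite !normrM (ger0_norm ex0).
have p1 : expR s * `|cos t - 1| <= 3 * (e / 8 * `|t|).
  by apply: ler_pM.
have p2 : expR s * `|sin t - t| <= 3 * (e / 8 * `|t|).
  by apply: ler_pM.
have p3 : `|expR s - 1| * `|t| <= 2 * (e / 8) * `|t|.
  rewrite ler_wpM2r//; apply: (le_trans nx); lra.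
have a0 := normr_ge0 s; have b0 := normr_ge0 t.
have es : 0 <= e * `|s| by rewrite mulr_ge0// ltW.
lra.
Qed.

(** Chain rule: the exponential is its own derivative, so the new derivative is [l * polar x y]. *)
Lemma hol_at_polar f x y : cdiff f (polar x y) ->
  hol_at (fun a b => f (polar a b)) x y.
Proof.
move=> [l fl]; exists (l * polar x y) => e e0.
set z := polar x y in fl *.
have nz0 := nm_ge0 z; have nl0 := nm_ge0 l.
have z0 : 0 < nm z + 1 by lra.
(* [e1] controls the remainder of [f], whose increment [k] is at most [(nm z + 1) * s]; [e2]
   controls [l] times the second order part [z * q] of that increment. Each gets half of [e]. *)
pose e1 := e / (2 * (nm z + 1)).
have e10 : 0 < e1 by rewrite divr_gt0// mulr_gt0.
have [d1 d10 H1] := fl e1 e10.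
pose e2 := Num.min 1 (e / (2 * (nm l * nm z + 1))).
have lz0 : 0 < nm l * nm z + 1 by rewrite ltr_wpDl// mulr_ge0.
have e20 : 0 < e2 by rewrite lt_min ltr01 divr_gt0// mulr_gt0.
have e2z0 : 0 < e2 / (nm z + 1) by rewrite divr_gt0.
have [d2 d20 H2] := polar_diff0 e2z0.
pose d3 := d1 / (2 * (nm z + 1)).
have d30 : 0 < d3 by rewrite divr_gt0// mulr_gt0.
exists (Num.min d2 d3); first by rewrite lt_min d20.
move=> x' y'; rewrite !le_min => /andP[x2 x3] /andP[y2 y3].
have := H2 _ _ x2 y2; set u := _ +i* _; set s := `|x' - x| + `|y' - y| => Hu.
have s0 : 0 <= s by rewrite addr_ge0.
have nu : nm u <= s by exact: nm_le_ReIm.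
have Ez : polar x' y' = z * polar (x' - x) (y' - y).
  by rewrite -polarD ![_ + (_ - _)]addrC !subrK.
set k := z * (polar (x' - x) (y' - y) - 1).
have zk : polar x' y' = z + k by rewrite Ez /k; ring.
pose q := polar (x' - x) (y' - y) - 1 - u.
have kE : k = z * u + z * q by rewrite /k /q; ring.
have nq : nm z * nm q <= e2 * s.
  have : nm z * nm q <= nm z * (e2 / (nm z + 1) * s) by rewrite ler_wpM2l.
  move=> /le_trans; apply.
  rewrite (_ : _ * _ = (nm z / (nm z + 1)) * (e2 * s)); last first.
    by move: (nm z) z0 => Z z0; field; lra.
  by rewrite ler_piMl ?mulr_ge0 ?(ltW e20)// ler_pdivrMr//; lra.
have e21 : e2 <= 1 by rewrite /e2 ge_min lexx.
have zqs : nm z * nm q <= s.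
  by apply: (le_trans nq); rewrite ler_piMl.
have nk : nm k <= (nm z + 1) * s.
  rewrite kE; apply: (le_trans (nmD _ _)); rewrite (nmM z u) (nmM z q) mulrDl mul1r.
  exact: (lerD (ler_wpM2l nz0 nu) zqs).
have kd : nm k <= d1.
  apply: (le_trans nk); have : s <= 2 * d3 by rewrite /s; lra.
  move=> /(ler_wpM2l (ltW z0))/le_trans; apply.
  rewrite /d3; clear -z0; move: (nm z) z0 => Z z0.
  suff -> : (Z + 1) * (2 * (d1 / (2 * (Z + 1)))) = d1 by [].
  by field; lra.
rewrite zk.
have -> : f (z + k) - f z - l * z * u = (f (z + k) - f z - l * k) + l * (z * q).
  by rewrite kE; ring.
apply: (le_trans (nmD _ _)); rewrite (nmM l) (nmM z q).
have A : nm (f (z + k) - f z - l * k) <= e / 2 * s.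
  apply: (le_trans (H1 _ kd)).
  have : e1 * nm k <= e1 * ((nm z + 1) * s) by rewrite ler_wpM2l// ltW.
  move=> /le_trans; apply; rewrite /e1; clear -z0; move: (nm z) z0 => Z z0.
  suff -> : e / (2 * (Z + 1)) * ((Z + 1) * s) = e / 2 * s by [].
  by field; lra.
have B : nm l * (nm z * nm q) <= e / 2 * s.
  have P : nm z * nm q <= nm z * (e2 / (nm z + 1) * s) by rewrite ler_wpM2l.
  have Q : nm l * (nm z * nm q) <= nm l * (nm z * (e2 / (nm z + 1) * s)).
    by rewrite ler_wpM2l.
  apply: (le_trans Q).
  have E2 : e2 <= e / (2 * (nm l * nm z + 1)) by rewrite /e2 ge_min lexx orbT.
  have E3 : e2 / (nm z + 1) <= e2.
    by rewrite ler_pdivrMr// ler_peMr ?(ltW e20)//; lra.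
  rewrite !mulrA ler_wpM2r//.
  have E4 := le_trans E3 E2.
  have : nm l * nm z * (e2 / (nm z + 1)) <=
     nm l * nm z * (e / (2 * (nm l * nm z + 1))).
    by rewrite ler_wpM2l// mulr_ge0.
  rewrite mulrA => /le_trans; apply.
  have m0 : 0 <= nm l * nm z by rewrite mulr_ge0.
  move: (nm l * nm z) m0 lz0 => m m0 m1.
  have -> : m * (e / (2 * (m + 1))) = e / 2 * (m / (m + 1)) by field; lra.
  by rewrite ler_piMr//; [lra|rewrite ler_pdivrMr//; lra].
lra.
Qed.

Definition tau : R := pi *+ 2.
Lemma tau_gt0 : 0 < tau. Proof. by rewrite mulrn_wgt0// pi_gt0. Qed.
Let tau_ge0 : 0 <= tau := ltW tau_gt0.
Lemma cis_tau : cis tau = 1. Proof. by rewrite /cis cos2pi sin2pi. Qed.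
Lemma cis0 : cis 0 = 1. Proof. by rewrite /cis cos0 sin0. Qed.

(** The contour integral of f(z) dz / (2 pi i z) over the circle of radius [r]. *)
Definition avg f r : R[i] := (tau^-1)%:C * cint 0 tau (fun t => f (r%:C * cis t)).

Definition circle_cont f r := cont_on 0 tau (fun t => f (r%:C * cis t)).

(** Goursat on the rectangle from [ln r0] to [ln r1] and from 0 to [tau]: the horizontal sides
    cancel by periodicity, and the vertical sides are the two means. *)
Theorem avg_const f r0 r1 : 0 < r0 -> r0 <= r1 ->
  (forall z, r0 <= nm z <= r1 -> cdiff f z) -> avg f r0 = avg f r1.
Proof.
move=> r00 r01 df; have r10 := lt_le_trans r00 r01.
pose h x y := f (polar x y).
have X01 : ln r0 <= ln r1 by rewrite ler_ln ?posrE.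
have hr : hol_rect h (ln r0) (ln r1) 0 tau.
  move=> x y /andP[x0 x1] _; apply: hol_at_polar; apply: df; rewrite nm_polar.
  by rewrite -[r0]lnK ?posrE// -[r1]lnK ?posrE// !ler_expR x0 x1.
have := goursat X01 tau_ge0 hr; rewrite /bd_int.
have c1 := @hol_rect_conty R h _ _ _ _ (ln r1) hr ltac:(by rewrite X01 lexx).
have c0 := @hol_rect_conty R h _ _ _ _ (ln r0) hr ltac:(by rewrite X01 lexx).
rewrite (cintB c1 c0).
rewrite (@eq_cint _ _ _ _ (fun=> 0)); last first.
  by move=> t _; rewrite /h /polar cis_tau cis0 subrr.
rewrite cint_cst// mul0r add0r => /eqP.
rewrite mulf_eq0 subr_eq0 => /orP[|/eqP E].
  by rewrite -nm_eq0 nm_i oner_eq0.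
rewrite /avg; congr (_ * _); symmetry.
transitivity (cint 0 tau (h (ln r1))).
  by apply: eq_cint => t _; rewrite /h /polar lnK ?posrE.
by rewrite E; apply: eq_cint => t _; rewrite /h /polar lnK ?posrE.
Qed.

End CircleMean.

(** * Continuity, linearity and bounds of circle means *)

Section Taylor.
Variable R : realType.
Implicit Types (f g : R[i] -> R[i]) (z a : R[i]) (r s t : R).

Definition ccont f z := forall e : R, 0 < e ->
  exists2 d : R, 0 < d & forall w, nm (w - z) < d -> nm (f w - f z) < e.

Lemma differentiable_ccont f z : differentiable f z -> ccont f z.
Proof. by move=> /differentiable_continuous/cvgCP fz e /fz /nbhsCP. Qed.

Lemma differentiable_cdiff f z : differentiable f z -> cdiff f z.
Proof. exact: differentiable_nmP. Qed.

(** Only the germ at [z] matters. This serves the function [q] of [cauchy_formula], which is defined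
    by cases. *)
Lemma cdiff_near f g z : (\forall w \near z, f w = g w) -> cdiff f z -> cdiff g z.
Proof.
move=> /nbhsCP[d d0 fg] [l fl]; exists l => e /fl[d' d'0 H].
exists (Num.min (d / 2) d'); first by rewrite lt_min d'0 divr_gt0.
move=> h; rewrite le_min => /andP[hd hd'].
have {1}<- : f (z + h) = g (z + h).
  by apply: fg; rewrite [z + h]addrC addrK; lra.
have <- : f z = g z by apply: fg; rewrite subrr nm0.
exact: H.
Qed.

Lemma cdiff_ccont f z : cdiff f z -> ccont f z.
Proof.
move=> [l fl]; move=> e e0; have [d d0 H] := fl 1 ltr01.
have nl0 := nm_ge0 l; have l1 : 0 < nm l + 2 by lra.
exists (Num.min d (e / (nm l + 2))); first by rewrite lt_min d0 divr_gt0.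
move=> w; rewrite lt_min => /andP[wd we].
have := H (w - z) (ltW wd); rewrite mul1r [z + _]addrC subrK => Hw.
rewrite -[f w - f z](subrK (l * (w - z))).
apply: (le_lt_trans (nmD _ _)); rewrite nmM.
apply: (@le_lt_trans _ _ ((nm l + 1) * nm (w - z))).
  by rewrite mulrDl mul1r addrC lerD2l.
have n0 := nm_ge0 (w - z).
move: we; rewrite ltr_pdivlMr// => we.
by apply: le_lt_trans we; rewrite mulrC ler_wpM2l//; lra.
Qed.

Lemma ccontD f g z : ccont f z -> ccont g z -> ccont (fun w => f w + g w) z.
Proof.
move=> F G; move=> e e0.
have e2 : 0 < e / 2 by rewrite divr_gt0.
have [d d0 fd] := F _ e2; have [c c0 gc] := G _ e2.
exists (Num.min d c) => [|w]; first by rewrite lt_min d0.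
rewrite lt_min => /andP[/fd A /gc B].
rewrite opprD addrACA; apply: (le_lt_trans (nmD _ _)); lra.
Qed.

Lemma ccont_cst (k : R[i]) z : ccont (fun=> k) z.
Proof. by move=> e e0; exists 1 => // w _; rewrite subrr nm0. Qed.

Lemma ccontM f g z : ccont f z -> ccont g z -> ccont (fun w => f w * g w) z.
Proof.
move=> F G; move=> e e0.
have f0 := nm_ge0 (f z); have g0 := nm_ge0 (g z).
pose e1 := Num.min 1 (e / (nm (f z) + nm (g z) + 2)).
have e10 : 0 < e1 by rewrite lt_min ltr01 divr_gt0//; lra.
have [d d0 fd] := F _ e10; have [c c0 gc] := G _ e10.
exists (Num.min d c) => [|w]; first by rewrite lt_min d0.
rewrite lt_min => /andP[/fd A /gc B].
have -> : f w * g w - f z * g z =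
  (f w - f z) * (g w - g z) + (f z * (g w - g z) + (f w - f z) * g z) by ring.
apply: (le_lt_trans (nmD _ _)).
apply: (le_lt_trans (lerD (lexx _) (nmD _ _))).
rewrite (nmM (f w - f z)) (nmM (f z)) (nmM _ (g z)).
have e11 : e1 <= 1 by rewrite /e1 ge_min lexx.
have P1 : nm (f w - f z) * nm (g w - g z) <= e1 * 1.
  by apply: ler_pM; rewrite ?nm_ge0// ltW//; apply: lt_le_trans B e11.
have P2 : nm (f z) * nm (g w - g z) <= nm (f z) * e1.
  by rewrite ler_wpM2l// ltW.
have P3 : nm (f w - f z) * nm (g z) <= e1 * nm (g z).
  by rewrite ler_wpM2r// ltW.
have : e1 * (nm (f z) + nm (g z) + 2) <= e.
  by rewrite -ler_pdivlMr ?ge_min ?lexx ?orbT//; lra.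
lra.
Qed.

Lemma cont_cis : continuous (@cis R).
Proof.
move=> t; apply/cvgCP => e e0.
have e2 : 0 < e / 2 by rewrite divr_gt0.
have /cvgrP/(_ _ e2) C := @continuous_cos R t.
have /cvgrP/(_ _ e2) S := @continuous_sin R t.
apply: filterS2 C S => x cx sx.
apply: (le_lt_trans (nm_le_ReIm _)); rewrite ReB ImB /=; lra.
Qed.

Lemma circle_contP f r : 0 <= r -> (forall z, nm z = r -> ccont f z) ->
  circle_cont f r.
Proof.
move=> r0 fc t _; apply/cvgCP => e e0.
have nr : nm (r%:C * cis t) = r by rewrite nm_rcis ger0_norm.
have [d d0 H] := fc _ nr e e0.
have r1 : 0 < r + 1 by rewrite ltr_wpDl.
have d1 : 0 < d / (r + 1) by rewrite divr_gt0.
have /cvgCP/(_ _ d1) := @cont_cis t; apply: filterS => x.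
rewrite ltr_pdivlMr// => xd; apply: H.
rewrite -mulrBr nmM nm_real ger0_norm//.
apply: le_lt_trans xd; rewrite mulrC ler_wpM2l ?nm_ge0//; lra.
Qed.

Lemma eq_avg f g r : 0 <= r -> (forall z, nm z = r -> f z = g z) ->
  avg f r = avg g r.
Proof.
move=> r0 fg; rewrite /avg; congr (_ * _); apply: eq_cint => t _.
by apply: fg; rewrite nm_rcis ger0_norm.
Qed.

Lemma avgD f g r : circle_cont f r -> circle_cont g r ->
  avg (fun z => f z + g z) r = avg f r + avg g r.
Proof. by move=> cf cg; rewrite /avg (cintD cf cg) mulrDr. Qed.

Lemma avgB f g r : circle_cont f r -> circle_cont g r ->
  avg (fun z => f z - g z) r = avg f r - avg g r.
Proof. by move=> cf cg; rewrite /avg (cintB cf cg) mulrBr. Qed.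

Lemma avgZ k f r : circle_cont f r -> avg (fun z => k * f z) r = k * avg f r.
Proof. by move=> cf; rewrite /avg (cintZ _ cf) mulrCA. Qed.

Let tau0 : 0 < tau R := tau_gt0 R.

Lemma avg_cst k r : avg (fun=> k) r = k.
Proof.
rewrite /avg cint_cst; last exact: ltW.
rewrite subr0 mulrCA -rmorphM mulVf ?gt_eqF// rmorph1 mulr1 //.
Qed.

Lemma avg_bound f r B : 0 <= r -> circle_cont f r ->
  (forall z, nm z = r -> nm (f z) <= B) -> nm (avg f r) <= 2 * B.
Proof.
move=> r0 cf fB.
have := cint_bound (ltW tau0) cf (fun t _ => fB _ _).
rewrite subr0 => H.
rewrite /avg nmM nm_real ger0_norm ?invr_ge0 ?(ltW tau0)// [_^-1 * _]mulrC ler_pdivrMr//.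
by apply: H => t; rewrite nm_rcis ger0_norm.
Qed.

(** Compactness of the parameter interval makes the continuity of the integrand uniform in the
    angle. The lemma carries means across radii where differentiability is not known, such as 0 and
    the modulus of a removable singularity. *)
Lemma avg_cvg f r d0 : 0 <= r -> 0 < d0 ->
  (forall z, `|nm z - r| < d0 -> ccont f z) ->
  forall e : R, 0 < e -> exists2 d : R, 0 < d &
    forall s, 0 <= s -> `|s - r| < d -> nm (avg f s - avg f r) <= e.
Proof.
move=> r0 d00 fc e e0.
have e2 : 0 < e / 2 by rewrite divr_gt0.
have e4 : 0 < e / 4 by rewrite divr_gt0.
have fr t : ccont f (r%:C * cis t).
  by apply: fc; rewrite nm_rcis (ger0_norm r0) subrr normr0.
have near_r : \forall s \near r, `[0, tau R] `<=`
    [set t | nm (f (s%:C * cis t) - f (r%:C * cis t)) < e / 2].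
  have /compact_near_coveringP cK := @segment_compact R 0 (tau R).
  apply: (cK R (nbhs r) (fun s t =>
    nm (f (s%:C * cis t) - f (r%:C * cis t)) < e / 2) _) => t _.
  have [d dpos H] := fr t _ e4.
  have r1 : 0 < r + 1 by rewrite ltr_wpDl.
  have d2 : 0 < d / 2 / (r + 1) by rewrite !divr_gt0.
  have /cvgCP/(_ _ d2) C := @cont_cis t.
  have C2 : \forall s \near r, `|s - r| < d / 2.
    by have /cvgrP/(_ (d / 2)) := @cvg_id _ (nbhs r); apply; rewrite divr_gt0.
  near=> t' s => /=.
  have ct : nm (cis t' - cis t) * (r + 1) < d / 2.
    by rewrite -ltr_pdivlMr//; near: t'.
  have sr : `|s - r| < d / 2 by near: s.
  have c0 := nm_ge0 (cis t' - cis t).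
  have rc : nm (r%:C * cis t' - r%:C * cis t) < d / 2.
    rewrite -mulrBr nmM nm_real ger0_norm//; apply: le_lt_trans ct.
    by rewrite mulrC ler_wpM2l//; lra.
  have sc : nm (s%:C * cis t' - r%:C * cis t) < d.
    have -> : s%:C * cis t' - r%:C * cis t =
      (s - r)%:C * cis t' + (r%:C * cis t' - r%:C * cis t).
      by rewrite rmorphB /=; ring.
    by apply: (le_lt_trans (nmD _ _)); rewrite nm_rcis; lra.
  have A := H _ sc; have B := H (r%:C * cis t') ltac:(lra).
  have -> : f (s%:C * cis t') - f (r%:C * cis t') =
    (f (s%:C * cis t') - f (r%:C * cis t)) - (f (r%:C * cis t') - f (r%:C * cis t)).
    by ring.
  by apply: (le_lt_trans (nmB _ _)); lra.
have [d dpos dP] : exists2 d : R, 0 < d & forall s, `|s - r| < d ->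
    `[0, tau R] `<=` [set t | nm (f (s%:C * cis t) - f (r%:C * cis t)) < e / 2].
  move: near_r => /nbhs_ballP[d /= dpos H]; exists d => // s sr; apply: H.
  by rewrite -ball_normE /= distrC.
exists (Num.min d d0); first by rewrite lt_min dpos.
move=> s s0; rewrite lt_min => /andP[/dP sd sd0].
have cs : circle_cont f s by apply: circle_contP => // z zs; apply: fc; rewrite zs.
have cr : circle_cont f r.
  by apply: circle_contP => // z zs; apply: fc; rewrite zs subrr normr0.
rewrite /avg -mulrBr -(cintB cs cr) nmM nm_real ger0_norm ?invr_ge0 ?(ltW tau0)//.
rewrite [_^-1 * _]mulrC ler_pdivrMr//.
have sd' t : 0 <= t <= tau R -> nm (f (s%:C * cis t) - f (r%:C * cis t)) <= e / 2.
  by move=> ht; apply/ltW/sd; rewrite /= in_itv.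
apply: (le_trans (cint_bound (ltW tau0) (cont_onB cs cr) sd')).
rewrite subr0 ler_wpM2r ?(ltW tau0)//; lra.
Unshelve. all: by end_near. Qed.

End Taylor.

(** * Cauchy's formula and Taylor expansions *)

Section Cauchy.
Variable R : realType.
Implicit Types (f g : R[i] -> R[i]) (z a : R[i]) (r s t : R).

Lemma diffC_cst (k : R[i]) z : differentiable (fun _ : R[i] => k) z.
Proof. exact: differentiable_cst. Qed.
Lemma diffC_D f g z : differentiable f z -> differentiable g z ->
  differentiable (fun w => f w + g w) z.
Proof. exact: differentiableD. Qed.
Lemma diffC_B f g z : differentiable f z -> differentiable g z ->
  differentiable (fun w => f w - g w) z.
Proof. exact: differentiableB. Qed.
Lemma diffC_M f g z : differentiable f z -> differentiable g z ->
  differentiable (fun w => f w * g w) z.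
Proof. exact: differentiableM. Qed.
Lemma diffC_V f z : differentiable f z -> f z != 0 ->
  differentiable (fun w => (f w)^-1) z.
Proof. exact: differentiableV. Qed.

Lemma avg_limit f r (c : R[i]) d0 : 0 <= r -> 0 < d0 ->
  (forall z, `|nm z - r| < d0 -> ccont f z) ->
  (forall d : R, 0 < d -> exists s, [/\ 0 <= s, `|s - r| < d & avg f s = c]) ->
  avg f r = c.
Proof.
move=> r0 d00 fc H; apply/eqP; rewrite -subr_eq0 -nm_eq0 eq_le nm_ge0 andbT.
apply/ler_addgt0Pr => e e0; rewrite add0r.
have [d dpos dP] := avg_cvg r0 d00 fc e0.
have [s [s0 sr <-]] := H d dpos.
by rewrite nmBC; exact: dP.
Qed.

Lemma avg_center f R0 r : (forall z, 0 < nm z < R0 -> differentiable f z) ->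
  ccont f 0 -> 0 < r < R0 -> avg f r = f 0.
Proof.
move=> df f0 /andP[r0 rR].
have fc z : nm z < R0 -> ccont f z.
  have [->//|z0] := eqVneq z 0; move=> zR; apply: differentiable_ccont.
  by apply: df; rewrite nm_gt0 z0.
transitivity (avg f 0); last first.
  rewrite /avg -[RHS](@avg_cst R (f 0) 0) /avg; congr (_ * _).
  by apply: eq_cint => t _; rewrite mul0r.
symmetry; apply: (@avg_limit _ _ _ R0) => //; first exact: lt_trans rR.
  by move=> z; rewrite subr0 ger0_norm ?nm_ge0//; exact: fc.
move=> d d0; have m0 : 0 < Num.min d r by rewrite lt_min d0.
have md : Num.min d r <= d by rewrite ge_min lexx.
have mr : Num.min d r <= r by rewrite ge_min lexx orbT.
exists (Num.min d r / 2); split; first lra.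
  by rewrite subr0 ger0_norm; lra.
apply: (@avg_const _ _ _ r); [lra|lra|].
move=> z /andP[z1 z2]; apply: differentiable_cdiff; apply: df; lra.
Qed.

(** The mean does not change when the radius grows, and z / (z - a) tends to 1 at infinity. *)
Lemma avg_cauchy_kernel a r : nm a < r -> avg (fun z => z / (z - a)) r = 1.
Proof.
move=> ar; have a0 := nm_ge0 a; have r0 := le_lt_trans a0 ar.
have za z s : r <= s -> nm z = s -> z - a != 0.
  move=> rs zs; rewrite -nm_gt0 (lt_le_trans _ (nm_triangle_sub _ _))//; lra.
have dk z : r <= nm z -> differentiable (fun z => z / (z - a)) z.
  move=> rz; apply: diffC_M; first exact: differentiable_idC.
  apply: diffC_V; last exact: (za z (nm z)).
  by apply: diffC_B; [exact: differentiable_idC|exact: diffC_cst].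
apply/eqP; rewrite -subr_eq0 -nm_eq0 eq_le nm_ge0 andbT.
apply/ler_addgt0Pr => e e0; rewrite add0r.
(* Chosen so that [nm a <= e / 2 * (s - nm a)]; [avg_bound] then doubles [e / 2]. *)
pose s := r + 2 * nm a / e.
have ae : 0 <= 2 * nm a / e by rewrite divr_ge0 ?mulr_ge0// ltW.
have rs : r <= s by rewrite /s lerDl.
rewrite (@avg_const _ _ r s r0 rs); last first.
  by move=> z /andP[rz _]; apply: differentiable_cdiff; exact: dk.
have s0 : 0 <= s by lra.
have ck : circle_cont (fun z => z / (z - a)) s.
  by apply: circle_contP => // z zs; apply/differentiable_ccont/dk; rewrite zs.
have c1 : circle_cont (fun=> 1 : R[i]) s by exact: cont_on_cst.
rewrite -(@avg_cst R 1 s) -(avgB ck c1).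
rewrite (_ : e = 2 * (e / 2)); last by field.
apply: (avg_bound s0 (cont_onB ck c1)) => z zs; have zan := za z s rs zs.
have -> : z / (z - a) - 1 = a / (z - a) by field.
rewrite nmM nmV ler_pdivrMr ?nm_gt0//.
have : s - nm a <= nm (z - a) by rewrite -zs nm_triangle_sub.
have e2 : 0 <= e / 2 by rewrite divr_ge0// ltW.
move=> /(ler_wpM2l e2); apply: le_trans.
rewrite /s (_ : e / 2 * _ = nm a + e / 2 * (r - nm a)); last first.
  by field; rewrite gt_eqF.
by rewrite lerDl mulr_ge0//; lra.
Qed.

(** The claim is that [q], the extension of z (f z - f a) / (z - a), has mean 0. Below radius [nm a]
    this is the value [q 0]. Continuity of [q] at [a] carries it to the radius [nm a] itself and
    then just beyond, where means are again constant. Only continuity at [a] is used, so no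
    removable singularity theorem is required. *)
Theorem cauchy_formula f R0 a r :
  (forall z, 0 < nm z < R0 -> differentiable f z) -> ccont f 0 ->
  nm a < r -> r < R0 -> avg (fun z => f z * (z / (z - a))) r = f a.
Proof.
move=> df f0 ar rR; have na0 := nm_ge0 a; have r0 := le_lt_trans na0 ar.
have [->|a0] := eqVneq a 0.
  rewrite -(@avg_center f R0 r)//; last by rewrite r0.
  apply: eq_avg; first exact: ltW.
  move=> z zr; rewrite subr0 divff ?mulr1// -nm_gt0 zr//.
have a0' : 0 < nm a by rewrite nm_gt0.
have aR : nm a < R0 by exact: lt_trans rR.
have [l fl] : cdiff f a by apply/differentiable_cdiff/df; rewrite a0'.
pose q z := if z == a then a * l else z * (f z - f a) / (z - a).
have dq z : 0 < nm z < R0 -> z != a ->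
    differentiable (fun z => z * (f z - f a) / (z - a)) z.
  move=> zR za; apply: diffC_M; [apply: diffC_M|apply: diffC_V].
  - exact: differentiable_idC.
  - by apply: diffC_B; [exact: df|exact: diffC_cst].
  - by apply: diffC_B; [exact: differentiable_idC|exact: diffC_cst].
  - by rewrite subr_eq0.
have qE z : z != a -> q z = z * (f z - f a) / (z - a).
  by rewrite /q => /negPf ->.
have qn z : z != a -> \forall w \near z, z * (f z - f a) / (z - a) = q z ->
    w * (f w - f a) / (w - a) = q w.
  move=> za; apply/nbhsCP; exists (nm (z - a)); first by rewrite nm_gt0 subr_eq0.
  move=> y yz _; rewrite qE//; apply: contraTneq yz => ->.
  by rewrite nmBC ltxx.
have qn' z : z != a -> \forall w \near z, w * (f w - f a) / (w - a) = q w.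
  by move=> za; have := qn z za; apply: filterS => w; apply; rewrite qE.
have cdq z : 0 < nm z < R0 -> z != a -> cdiff q z.
  move=> zR za; apply: (cdiff_near (qn' z za)).
  exact: (differentiable_cdiff (dq z zR za)).
have q0 : q 0 = 0 by rewrite qE ?mul0r// eq_sym.
have cont0 : ccont (fun z => z * (f z - f a) / (z - a)) 0.
  apply: ccontM; [apply: ccontM|].
  - exact/differentiable_ccont/differentiable_idC.
  - by apply: ccontD; [exact: f0|exact: ccont_cst].
  - apply/differentiable_ccont/diffC_V; last by rewrite sub0r oppr_eq0.
    by apply: diffC_B; [exact: differentiable_idC|exact: diffC_cst].
have cq z : nm z < R0 -> ccont q z.
  move=> zR; have [->|za] := eqVneq z a.
    move=> e e0.
    have l1 : 0 < 2 * (nm l + 1) by have := nm_ge0 l; lra.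
    pose e1 := Num.min 1 (e / (4 * nm a)).
    have e10 : 0 < e1 by rewrite lt_min ltr01 divr_gt0// mulr_gt0.
    have [d d0 H] := fl e1 e10.
    have m1 : 0 < 2 * (nm l + 1) by [].
    exists (Num.min (Num.min d (nm a)) (e / (2 * (nm l + 1)))).
      by rewrite !lt_min d0 a0' divr_gt0.
    move=> w; rewrite !lt_min => /andP[/andP[wd wa] we].
    have [->|wna] := eqVneq w a; first by rewrite subrr nm0.
    have wa0 : 0 < nm (w - a) by rewrite nm_gt0 subr_eq0.
    have := H (w - a) (ltW wd); rewrite [a + _]addrC subrK => Hw.
    have wan : w - a != 0 by rewrite subr_eq0.
    rewrite qE// {1}/q eqxx.
    (* The first summand is small by differentiability at [a], where [nm w <= 2 * nm a] explains the
       4 in [e1]; the second vanishes with [w - a]. *)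
    have -> : w * (f w - f a) / (w - a) - a * l =
      w * (f w - f a - l * (w - a)) / (w - a) + (w - a) * l by field.
    apply: (le_lt_trans (nmD _ _)).
    rewrite nmM nmV nmM [nm ((w - a) * l)]nmM.
    have nw : nm w <= 2 * nm a.
      rewrite -[w](subrK a); apply: (le_trans (nmD _ _)); lra.
    have P1 : nm w * nm (f w - f a - l * (w - a)) / nm (w - a) <= e / 2.
      rewrite ler_pdivrMr//.
      have : nm w * nm (f w - f a - l * (w - a)) <= (2 * nm a) * (e1 * nm (w - a)).
        by apply: ler_pM => //; exact: nm_ge0.
      move=> /le_trans; apply; rewrite mulrA ler_wpM2r ?nm_ge0//.
      have : e1 <= e / (4 * nm a) by rewrite /e1 ge_min lexx orbT.
      have m2 : 0 <= 2 * nm a by rewrite mulr_ge0.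
      move=> /(ler_wpM2l m2)/le_trans; apply.
      clear -a0'; move: (nm a) a0' => A A0.
      by suff -> : 2 * A * (e / (4 * A)) = e / 2 by []; field; rewrite gt_eqF.
    have P2 : nm (w - a) * nm l < e / 2.
      have L0 := nm_ge0 l.
      move: we; rewrite ltr_pdivlMr// => we.
      have : nm (w - a) * nm l <= nm (w - a) * (nm l + 1).
        by rewrite ler_wpM2l ?nm_ge0// lerDl.
      move: we; set p := _ * (nm l + 1); rewrite mulrCA -/p => we; lra.
    lra.
  have [z0|z0] := eqVneq z 0; last first.
    by apply/cdiff_ccont/cdq => //; rewrite nm_gt0 z0.
  rewrite z0 in za *; move=> e /cont0[d d0 H].
  have /nbhsCP[d' d'0 H'] := qn' 0 za.
  exists (Num.min d d'); first by rewrite lt_min d0.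
  move=> w; rewrite lt_min => /andP[/H A /H' <-].
  by move: A; rewrite qE.
have avq0 s : 0 < s < nm a -> avg q s = 0.
  move=> /andP[s0 sa].
  transitivity (avg (fun z => z * (f z - f a) / (z - a)) s).
    apply: eq_avg; first exact: ltW.
    by move=> z zs; rewrite qE//; apply: contraTneq sa => <-; rewrite zs ltxx.
  have dz z : 0 < nm z < nm a ->
      differentiable (fun z => z * (f z - f a) / (z - a)) z.
    move=> /andP[z0 za]; apply: dq; first by rewrite z0 (lt_trans za aR).
    by apply: contraTneq za => ->; rewrite ltxx.
  rewrite (avg_center dz cont0); last by rewrite s0.
  by rewrite !mul0r.
have cqa z : `|nm z - nm a| < R0 - nm a -> ccont q z.
  by rewrite ltr_norml => /andP[? ?]; apply: cq; lra.
have Ra : 0 < R0 - nm a by rewrite subr_gt0.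
have avqa : avg q (nm a) = 0.
  apply: (avg_limit na0 Ra cqa) => d d0.
  have m0 : 0 < Num.min d (nm a) by rewrite lt_min d0.
  have md : Num.min d (nm a) <= d by rewrite ge_min lexx.
  have ma : Num.min d (nm a) <= nm a by rewrite ge_min lexx orbT.
  exists (nm a - Num.min d (nm a) / 2); split; first lra.
    by rewrite ltr_norml; lra.
  by apply: avq0; lra.
have avqr : avg q r = 0.
  rewrite -avqa; symmetry; apply: (avg_limit na0 Ra cqa) => d d0.
  pose s := nm a + Num.min (d / 2) (r - nm a).
  have m0 : 0 < Num.min (d / 2) (r - nm a) by rewrite lt_min divr_gt0// subr_gt0.
  have md : Num.min (d / 2) (r - nm a) <= d / 2 by rewrite ge_min lexx.
  have ma : Num.min (d / 2) (r - nm a) <= r - nm a by rewrite ge_min lexx orbT.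
  exists s; split; first by rewrite /s; lra.
    by rewrite /s ltr_norml; lra.
  apply: avg_const; [by rewrite /s; lra|by rewrite /s; lra|].
  move=> z /andP[sz zr]; apply: cdq; first by rewrite /s in sz; apply/andP; lra.
  by apply: contraTneq sz => ->; rewrite -ltNge /s; lra.
have zar z : nm z = r -> z - a != 0.
  by move=> zr; rewrite -nm_gt0 (lt_le_trans _ (nm_triangle_sub _ _))//; lra.
have dk z : nm z = r -> differentiable (fun z => z / (z - a)) z.
  move=> zr; apply: diffC_M; first exact: differentiable_idC.
  apply: diffC_V; last exact: zar.
  by apply: diffC_B; [exact: differentiable_idC|exact: diffC_cst].
have ck : circle_cont (fun z => z / (z - a)) r.
  by apply: circle_contP; [exact: ltW|move=> z /dk/differentiable_ccont].
have cfk : circle_cont (fun z => f z * (z / (z - a))) r.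
  apply: circle_contP; first exact: ltW.
  move=> z zr; apply/differentiable_ccont/diffC_M; last exact: dk.
  by apply: df; rewrite zr r0.
have cfak : circle_cont (fun z => f a * (z / (z - a))) r.
  apply: circle_contP; first exact: ltW.
  by move=> z zr; apply/differentiable_ccont/diffC_M; [exact: diffC_cst|exact: dk].
apply/eqP; rewrite -subr_eq0 -[X in _ - X]mulr1 -(avg_cauchy_kernel ar).
rewrite -(avgZ _ ck) -(avgB cfk cfak) -avqr; apply/eqP.
apply: eq_avg; first exact: ltW.
move=> z zr; have := zar z zr; rewrite subr_eq0 => za; rewrite qE//; ring.
Qed.

End Cauchy.

(** * Taylor coefficients, remainder estimates and the maximum principle *)

Section TaylorExpansion.
Variable R : realType.
Implicit Types (f g : R[i] -> R[i]) (z a : R[i]) (r s t : R).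

(** Only continuity is asked at 0, so that the Taylor estimate applies directly to the inversion of
    an entire function, 1 / f(1 / w), in [entire_proper_growth]. *)
Definition punctured_hol R0 f :=
  (forall z, 0 < nm z < R0 -> differentiable f z) /\ ccont f 0.

Definition coef f d r : R[i] := avg (fun z => f z * z^-1 ^+ d) r.

Lemma cis_surj z : nm z = 1 -> exists2 t, 0 <= t <= tau R & z = cis t.
Proof.
case: z => x y /eqP; rewrite /= -(eqrXn2 (ltn0Sn 1)) ?sqrtr_ge0// expr1n.
rewrite sqr_sqrtr ?addr_ge0 ?sqr_ge0// => /eqP xy.
have y0 := sqr_ge0 y; have x0 := sqr_ge0 x.
have x1 : -1 <= x <= 1.
  by rewrite -ler_norml -(ler_pXn2r (ltn0Sn 1)) ?nnegrE// real_normK ?num_real//; lra.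
have sx : sin (acos x) = `|y|.
  by rewrite sin_acos// (_ : 1 - x ^+ 2 = y ^+ 2) ?sqrtr_sqr//; lra.
have a0 := acos_ge0 x1; have a1 := acos_lepi x1; have p0 := pi_ge0 R.
have [yp|yn] := leP 0 y.
  exists (acos x); first by rewrite a0 /tau mulr2n; lra.
  by rewrite /cis acosK ?in_itv// sx ger0_norm.
exists (tau R - acos x); first by rewrite /tau mulr2n; lra.
rewrite /cis /tau [_ - acos x]addrC cosD2pi sinD2pi cosN sinN acosK ?in_itv//.
by rewrite sx ltr0_norm// opprK.
Qed.

Lemma exp_unbounded (x C : R) : 1 < x -> exists n, C < x ^+ n.
Proof.
move=> x1; have x0 : 0 < x by apply: lt_trans x1.
have lx : 0 < ln x by rewrite ln_gt0.
exists (Num.truncn (`|C| / ln x)).+1; set n := _.+1.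
have Cn : `|C| / ln x < n%:R by exact: truncnS_gt.
have -> : x ^+ n = expR (n%:R * ln x).
  by rewrite mulr_natl -[in RHS]lnXn// lnK// posrE exprn_gt0.
apply: lt_le_trans (expR_ge1Dx _).
move: Cn; rewrite ltr_pdivrMr// => Cn; have := ler_norm C; lra.
Qed.

Lemma geom_small (x K e : R) : 0 <= x < 1 -> 0 < e -> exists n, K * x ^+ n <= e.
Proof.
move=> /andP[x0 x1] e0; have [xe|xn] := eqVneq x 0.
  by exists 1%N; rewrite xe expr1 mulr0 ltW.
have xp : 0 < x by rewrite lt_neqAle eq_sym xn.
have [n nP] := @exp_unbounded x^-1 (K / e) ltac:(by rewrite invf_gt1).
exists n; move: nP; rewrite ltr_pdivrMr// exprVn => /ltW.
by rewrite mulrC ler_pdivlMr ?exprn_gt0.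
Qed.

Lemma geom_eq0 (c : R[i]) (K x : R) : 0 <= x < 1 ->
  (forall n, nm c <= K * x ^+ n) -> c = 0.
Proof.
move=> x01 H; apply/eqP; rewrite -nm_eq0 eq_le nm_ge0 andbT.
apply/ler_addgt0Pr => e e0; rewrite add0r.
by have [n nP] := geom_small K x01 e0; exact: le_trans (H n) nP.
Qed.

Section Fixed.
Variables (f : R[i] -> R[i]) (R0 : R).
Hypothesis fh : punctured_hol R0 f.

Lemma diff_expV n z : z != 0 -> differentiable (fun w : R[i] => w^-1 ^+ n) z.
Proof.
move=> z0; apply: differentiable_expC.
by apply: diffC_V; [exact: differentiable_idC|].
Qed.

Lemma diff_kernel a z : z != a -> differentiable (fun w : R[i] => w / (w - a)) z.
Proof.
move=> za; apply: diffC_M; first exact: differentiable_idC.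
apply: diffC_V; last by rewrite subr_eq0.
by apply: diffC_B; [exact: differentiable_idC|exact: diffC_cst].
Qed.

Lemma diff_coef d z : 0 < nm z < R0 -> differentiable (fun w => f w * w^-1 ^+ d) z.
Proof.
move=> zR; apply: diffC_M; first exact: fh.1.
by apply: diff_expV; rewrite -nm_gt0; case/andP: zR.
Qed.

Lemma coef_cont d r : 0 < r < R0 -> circle_cont (fun w => f w * w^-1 ^+ d) r.
Proof.
move=> rR; apply: circle_contP; first by case/andP: rR => /ltW.
by move=> z zr; apply/differentiable_ccont/diff_coef; rewrite zr.
Qed.

Lemma coef_radius d r s : 0 < r -> r <= s -> s < R0 -> coef f d r = coef f d s.
Proof.
move=> r0 rs sR; apply: avg_const => // z /andP[z1 z2].
apply/differentiable_cdiff/diff_coef.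
by rewrite (lt_le_trans r0 z1) (le_lt_trans z2 sR).
Qed.

Lemma coef_bound d r B : 0 < r < R0 -> (forall z, nm z = r -> nm (f z) <= B) ->
  nm (coef f d r) * r ^+ d <= 2 * B.
Proof.
move=> rR fB; have r0 : 0 < r by case/andP: rR.
rewrite -ler_pdivlMr ?exprn_gt0// -mulrA /coef.
apply: (avg_bound (ltW r0) (@coef_cont d r rR)) => z zr.
by rewrite nmM nmX nmV zr exprVn ler_wpM2r ?invr_ge0 ?exprn_ge0 ?(ltW r0)// fB.
Qed.

(** Iterating z / (z - a) = 1 + (a / z) (z / (z - a)) in Cauchy's formula splits off one coefficient
    at a time and leaves the integrand [rem], which carries the factor (a / z)^k. Everything is a
    finite sum, with no series to interchange with an integral. *)
Lemma taylor r a B n : nm a < r -> r < R0 ->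
  (forall z, nm z = r -> nm (f z) <= B) ->
  nm (f a - \sum_(d < n) coef f d r * a ^+ d)
    <= 2 * B * (nm a / r) ^+ n * (r / (r - nm a)).
Proof.
move=> ar rR fB; have a0 := nm_ge0 a; have r0 := le_lt_trans a0 ar.
have rR' : 0 < r < R0 by rewrite r0.
have za z : nm z = r -> z != a.
  by move=> zr; apply: contraTneq ar => <-; rewrite zr ltxx.
pose rem k z := f z * (a * z^-1) ^+ k * (z / (z - a)).
have dk k z : nm z = r -> differentiable (fun z => (a * z^-1) ^+ k) z.
  move=> zr; apply: differentiable_expC; apply: diffC_M; first exact: diffC_cst.
  by apply: diffC_V; [exact: differentiable_idC|rewrite -nm_gt0 zr].
have crem k : circle_cont (rem k) r.
  apply: circle_contP; first exact: ltW.
  move=> z zr; apply/differentiable_ccont/diffC_M.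
    by apply: diffC_M; [apply: fh.1; rewrite zr|exact: dk].
  by apply: diff_kernel; exact: za.
have cT k : circle_cont (fun z => a ^+ k * (f z * z^-1 ^+ k)) r.
  apply: circle_contP; first exact: ltW.
  move=> z zr; apply/differentiable_ccont/diffC_M; first exact: diffC_cst.
  by apply: diff_coef; rewrite zr.
have E k : f a = \sum_(d < k) coef f d r * a ^+ d + avg (rem k) r.
  elim: k => [|k IH].
    rewrite big_ord0 add0r -(cauchy_formula fh.1 fh.2 ar rR).
    apply: eq_avg; first exact: ltW.
    by move=> z zr; rewrite /rem expr0 mulr1.
  rewrite big_ord_recr /= -addrA [LHS]IH; congr (_ + _).
  rewrite mulrC /coef -(avgZ _ (@coef_cont k r rR')) -(avgD (cT k) (crem k.+1)).
  apply: eq_avg; first exact: ltW.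
  move=> z zr; have := za z zr; rewrite -subr_eq0 => zan.
  have zn : z != 0 by rewrite -nm_gt0 zr.
  rewrite /rem exprS exprMn; move: (z^-1 ^+ k) => u; field.
  by rewrite zan zn.
rewrite {1}(E n) addrC addKr -!mulrA.
apply: (avg_bound (ltW r0) (crem n)) => z zr.
rewrite /rem nmM nmM nmX nmM nmM !nmV zr [leRHS]mulrA.
have B0 : 0 <= B by apply: le_trans (fB z zr); exact: nm_ge0.
have ran : 0 < r - nm a by rewrite subr_gt0.
have zan : r - nm a <= nm (z - a) by rewrite -zr nm_triangle_sub.
have p0 : 0 <= nm a / r by rewrite divr_ge0// ltW.
apply: ler_pM.
- exact: mulr_ge0 (nm_ge0 _) (exprn_ge0 _ p0).
- by rewrite divr_ge0 ?nm_ge0// ltW.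
- exact: ler_wpM2r (exprn_ge0 _ p0) _ _ (fB z zr).
- apply: (ler_wpM2l (ltW r0)).
  by rewrite lef_pV2 ?posrE//; exact: lt_le_trans zan.
Qed.

Lemma circle_bounded r : 0 < r < R0 ->
  exists2 B : R, 0 <= B & forall z, nm z = r -> nm (f z) <= B.
Proof.
move=> rR; have r0 : 0 < r by case/andP: rR.
have C : circle_cont f r.
  apply: circle_contP; first exact: ltW.
  by move=> z zr; apply/differentiable_ccont/fh.1; rewrite zr.
have /compact_near_coveringP cK := @segment_compact R 0 (tau R).
have H : \forall B \near +oo, `[0, tau R] `<=`
    [set t | nm (f (r%:C * cis t)) <= B].
  apply: (cK R (+oo)%R (fun B t => nm (f (r%:C * cis t)) <= B) _) => t.
  rewrite /= in_itv /= => /C/cvgCP/(_ 1 ltr01) Ct.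
  near=> t' B.
  have h1 : nm (f (r%:C * cis t') - f (r%:C * cis t)) < 1 by near: t'.
  have h2 : nm (f (r%:C * cis t)) + 1 <= B.
    by near: B; apply: nbhs_pinfty_ge; exact: num_real.
  rewrite -[f (r%:C * cis t')](subrK (f (r%:C * cis t))).
  apply: (le_trans (nmD _ _)); apply: le_trans h2.
  by rewrite [leRHS]addrC lerD2r ltW.
have [B BP] := filter_ex H.
exists `|B| => // z zr.
have [t tt zE] := @cis_surj (r^-1%:C * z) ltac:(by
  rewrite nmM nm_real zr ger0_norm ?invr_ge0 ?(ltW r0)// mulVf ?gt_eqF).
have -> : z = r%:C * cis t.
  by rewrite -zE mulrA -rmorphM mulfV ?gt_eqF// rmorph1 mul1r.
by apply: le_trans (ler_norm B); apply: BP; rewrite /= in_itv.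
Unshelve. all: by end_near. Qed.

End Fixed.

(* Applying the crude Cauchy bound to the powers of [f] and taking [k]-th roots
   removes the constant. *)
Theorem max_modulus f R0 r a B : (forall z, nm z < R0 -> differentiable f z) ->
  nm a < r -> r < R0 -> (forall z, nm z = r -> nm (f z) <= B) -> nm (f a) <= B.
Proof.
move=> df ar rR fB; have a0 := nm_ge0 a; have r0 := le_lt_trans a0 ar.
have B0 : 0 <= B.
  by apply: le_trans (fB (r%:C) _); [exact: nm_ge0|rewrite nm_real gtr0_norm].
rewrite leNgt; apply/negP => fa.
have P k : nm (f a) ^+ k <= 2 * B ^+ k * (r / (r - nm a)).
  have ph : punctured_hol R0 (fun z => f z ^+ k).
    split=> [z /andP[_ zR]|]; first by apply: differentiable_expC; exact: df.
    apply/differentiable_ccont/differentiable_expC/df; rewrite nm0.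
    exact: lt_trans rR.
  have := @taylor _ _ ph r a (B ^+ k) 0%N ar rR.
  rewrite big_ord0 subr0 expr0 mulr1 nmX; apply => z zr.
  by rewrite nmX lerXn2r ?nnegrE ?nm_ge0// fB.
have [Bz|Bn] := eqVneq B 0.
  have := P 1%N; rewrite Bz !expr1 mulr0 mul0r leNgt.
  by rewrite (le_lt_trans _ fa) ?Bz.
have Bp : 0 < B by rewrite lt_neqAle eq_sym Bn.
have [k] := @exp_unbounded (nm (f a) / B) (2 * (r / (r - nm a)))
  ltac:(by rewrite ltr_pdivlMr// mul1r).
rewrite expr_div_n ltr_pdivlMr ?exprn_gt0// ltNge => /negP; apply.
by apply: le_trans (P k) _; rewrite mulrAC.
Qed.

End TaylorExpansion.

(** * Several variables: bounds from tori *)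

Section SeveralVariables.
Variable R : realType.

Lemma cis_eq1 t : cis t = 1 :> R[i] -> `|t| < tau R -> t = 0.
Proof.
move=> [ct _] tt; apply/eqP; rewrite -normr_eq0.
have cn : cos `|t| = 1 by case: (ger0P t) => _; rewrite ?cosN.
have p0 := pi_ge0 R; have t0 := normr_ge0 t; rewrite /tau mulr2n in tt.
have [tp|tp] := leP `|t| pi.
  apply/eqP/(@cos_inj R); rewrite ?in_itv /= ?lexx ?t0 ?tp ?p0//.
  by rewrite cn cos0.
have : pi *+ 2 - `|t| = 0.
  apply/(@cos_inj R); rewrite ?in_itv /= ?lexx ?p0//.
    by rewrite mulr2n; lra.
  by rewrite cos0 addrC cosD2pi cosN.
by rewrite mulr2n; lra.
Qed.

Definition unity_root (N : nat) : R[i] := cis (tau R / N%:R).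

Lemma cis_exp t n : cis t ^+ n = cis (n%:R * t) :> R[i].
Proof.
elim: n => [|n IH]; first by rewrite expr0 mul0r cis0.
by rewrite exprS IH -cisD -[n.+1%:R]natr1 mulrDl mul1r addrC.
Qed.

(** Discrete orthogonality of the powers. Distinct exponents below [N] differ by less than [N], so
    the ratio [x] is an N-th root of unity other than 1 and its geometric sum vanishes. *)
Lemma sum_unity_root N d e : (d < N)%N -> (e < N)%N ->
  \sum_(j < N) (unity_root N ^+ j) ^+ e * (unity_root N ^+ j)^-1 ^+ d
    = if e == d then N%:R else 0 :> R[i].
Proof.
move=> dN eN; have N0 : (0 < N)%N by exact: leq_ltn_trans dN.
set w := unity_root N; have w0 : w != 0 by rewrite -nm_gt0 nm_cis.
pose x := w ^+ e * w^-1 ^+ d.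
have E j : (w ^+ j) ^+ e * (w ^+ j)^-1 ^+ d = x ^+ j.
  by rewrite exprMn -exprVn -!exprM ![(j * _)%N]mulnC.
under eq_bigr do rewrite E.
case: eqP => [ed|/eqP ed].
  have -> : x = 1 by rewrite /x ed exprVn mulfV// expf_neq0.
  by under eq_bigr do rewrite expr1n; rewrite sumr_const card_ord.
have wN : w ^+ N = 1.
  by rewrite cis_exp mulrCA mulfV ?mulr1 ?cis_tau// pnatr_eq0 -lt0n.
have xN : x ^+ N = 1.
  by rewrite exprMn -!exprM ![(_ * N)%N]mulnC !exprM exprVn wN invr1 !expr1n mulr1.
have x1 : x != 1.
  apply/eqP => x1; pose t := (e%:R - d%:R) * (tau R / N%:R).
  have xt : cis t = x.
    apply: (@mulIf _ (w ^+ d)); first by rewrite expf_neq0.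
    rewrite /x -mulrA exprVn mulVf ?expf_neq0// mulr1 /w !cis_exp -cisD.
    by congr cis; rewrite /t mulrBl subrK.
  have tN : `|t| < tau R.
    have tau0 := tau_gt0 R.
    have tN0 : 0 <= tau R / N%:R by rewrite divr_ge0 ?ler0n// ltW.
    rewrite normrM (ger0_norm tN0).
    rewrite mulrA ltr_pdivrMr ?ltr0n// mulrC ltr_pM2l ?tau_gt0//.
    rewrite ltr_norml; have : (d%:R : R) < N%:R by rewrite ltr_nat.
    have : (e%:R : R) < N%:R by rewrite ltr_nat.
    have : (0 : R) <= d%:R by rewrite ler0n.
    have : (0 : R) <= e%:R by rewrite ler0n.
    lra.
  have /eqP := cis_eq1 (etrans xt x1) tN.
  rewrite mulf_eq0 subr_eq0 eqr_nat (negPf ed) /= gt_eqF//.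
  by rewrite divr_gt0 ?tau_gt0// ltr0n.
apply/eqP; have := subrX1 x N; rewrite xN subrr => /esym/eqP.
by rewrite mulf_eq0 subr_eq0 (negPf x1).
Qed.

(** [coef] at radius 1 with the integral replaced by a finite sum, so that holomorphic dependence on
    a parameter needs no differentiation under an integral. *)
Definition root_avg (f : R[i] -> R[i]) N d : R[i] :=
  N%:R^-1 * \sum_(j < N) f (unity_root N ^+ j) * (unity_root N ^+ j)^-1 ^+ d.

(** By discrete orthogonality the average is exact on the Taylor polynomial of degree below [N];
    only the Taylor remainder at points of modulus 1 contributes. *)
Lemma root_avgP f R0 r B N d : punctured_hol R0 f -> 1 < r -> r < R0 -> (d < N)%N ->
  (forall z, nm z = r -> nm (f z) <= B) ->
  nm (root_avg f N d - coef f d r) <= 2 * B * (r^-1) ^+ N * (r / (r - 1)).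
Proof.
move=> fh r1 rR dN fB; have N0 : (0 < N)%N by exact: leq_ltn_trans dN.
have Nn : (N%:R : R[i]) != 0 by rewrite -nm_gt0 nm_nat ltr0n.
have cE : coef f d r = N%:R^-1 * \sum_(j < N)
    (\sum_(e < N) coef f e r * (unity_root N ^+ j) ^+ e) *
    (unity_root N ^+ j)^-1 ^+ d.
  apply: (@mulfI _ N%:R) => //; rewrite [RHS]mulrA mulfV// mul1r.
  under eq_bigr do rewrite mulr_suml.
  rewrite exchange_big /= (bigD1 (Ordinal dN)) //= [X in _ + X]big1 ?addr0.
    under eq_bigr do rewrite -mulrA.
    by rewrite -mulr_sumr sum_unity_root// eqxx mulrC.
  move=> e ed; under eq_bigr do rewrite -mulrA.
  rewrite -mulr_sumr sum_unity_root// ifN ?mulr0//.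
rewrite /root_avg {1}cE -mulrBr -sumrB nmM nmV nm_nat.
rewrite mulrC ler_pdivrMr ?ltr0n//.
apply: (le_trans (nm_sum _ _ _)).
rewrite mulr_natr -[X in _ *+ X]card_ord -sumr_const.
apply: ler_sum => j _; rewrite -mulrBl nmM.
have nw : nm (unity_root N ^+ j) = 1 by rewrite nmX nm_cis expr1n.
rewrite nmX nmV nw invr1 expr1n mulr1.
have := @taylor R f R0 fh r (unity_root N ^+ j) B N.
by rewrite nw mul1r; apply.
Qed.

Lemma diffC_sum N (h : nat -> R[i] -> R[i]) z :
  (forall j, (j < N)%N -> differentiable (h j) z) ->
  differentiable (fun w => \sum_(j < N) h j w) z.
Proof.
elim: N => [|N IH] H.
  rewrite (_ : (fun _ => _) = (fun=> 0)); last by apply/funext => w; rewrite big_ord0.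
  exact: diffC_cst.
rewrite (_ : (fun _ => _) = (fun w => \sum_(j < N) h j w + h N w)); last first.
  by apply/funext => w; rewrite big_ord_recr.
apply: diffC_D; last exact: H.
by apply: IH => j jN; apply: H; exact: ltnW.
Qed.

Variable n : nat.
Notation V := 'rV[R[i]]_n.
Implicit Types (g : V -> R[i]) (p u v w z : V).

(** Differentiability along complex lines through [p] is all that the one-variable arguments need,
    and it passes easily to sums and to linear substitutions. *)
Definition line_diff g p := forall z v c, z + c *: v = p ->
  differentiable (fun t : R[i] => g (z + t *: v)) c.

Lemma differentiable_line_diff g p : differentiable g p -> line_diff g p.
Proof.
move=> dg z v c zc.
rewrite (_ : (fun _ => _) = g \o (fun t : R[i] => z + t *: v))//.
apply: differentiable_comp; last by rewrite zc.
apply: differentiableD; first exact: differentiable_cst.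
apply: differentiableZl; exact: differentiable_idC.
Qed.

Definition set_coord z (k : 'I_n) (c : R[i]) : V :=
  \row_j (if j == k then c else z ord0 j).

Lemma set_coordE z k c : set_coord z k c = set_coord z k 0 + c *: delta_mx ord0 k.
Proof.
apply/rowP => j; rewrite !mxE eqxx /=; case: eqP => _.
  by rewrite mulr1 add0r.
by rewrite mulr0 addr0.
Qed.

Lemma set_coord_id z k : set_coord z k (z ord0 k) = z.
Proof. by apply/rowP => j; rewrite mxE; case: eqP => [->|]. Qed.

Theorem polydisc_max g (s B : R) : 0 < s ->
  (forall z, (forall k, nm (z ord0 k) < 2 * s) -> line_diff g z) ->
  (forall z, (forall k, nm (z ord0 k) = s) -> nm (g z) <= B) ->
  forall z, (forall k, nm (z ord0 k) <= s) -> nm (g z) <= B.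
Proof.
move=> s0 dg gB.
(* Coordinates are pushed to the circle one at a time: those of index at least [j] already lie on
   it, and the maximum principle in coordinate [j] gives the induction step. *)
suff H j z : (forall k, nm (z ord0 k) <= s) ->
    (forall k : 'I_n, (j <= k)%N -> nm (z ord0 k) = s) -> nm (g z) <= B.
  move=> z zs; apply: (H n) => // k; rewrite leqNgt.
  by have -> : (k < n)%N by [].
elim: j z => [|j IH] z zs zj; first by apply: gB => k; exact: zj.
have [nj|jn] := leqP n j.
  by apply: IH => // k jk; have := ltn_ord k; rewrite ltnNge (leq_trans nj jk).
pose k0 := Ordinal jn.
have [zk|zk] := eqVneq (nm (z ord0 k0)) s.
  apply: IH => // k; rewrite leq_eqVlt => /orP[/eqP jk|]; last exact: zj.
  by rewrite (_ : k = k0)//; apply/val_inj.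
rewrite -(set_coord_id z k0).
apply: (@max_modulus _ (fun c => g (set_coord z k0 c)) (2 * s) s) => //.
- move=> c cs; rewrite (_ : (fun _ => _) =
    (fun t : R[i] => g (set_coord z k0 0 + t *: delta_mx ord0 k0))); last first.
    by apply/funext => t; rewrite set_coordE.
  apply: (dg (set_coord z k0 c)); last by rewrite -set_coordE.
  move=> k; rewrite mxE; case: eqP => // _.
  by apply: le_lt_trans (zs k) _; lra.
- by rewrite lt_neqAle zk zs.
- lra.
- move=> c cs; apply: IH => k; rewrite mxE; case: eqP => [_|].
  + by rewrite cs.
  + by move=> _; exact: zs.
  + by [].
  + move=> /eqP kk jk; apply: zj; rewrite ltn_neqAle jk andbT eq_sym.
    by apply: contra kk => /eqP jk'; apply/eqP/val_inj.
Qed.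

(** * Bounding a function on a balanced domain by its values on a torus *)

Section TorusBound.
Variables (U : set V) (g : V -> R[i]) (s0 B0 : R).
Hypothesis Ubal : forall z c, U z -> nm c <= 1 -> U (c *: z).
Hypothesis Uopen : forall z, U z -> exists2 t : R, 1 < t & U (t%:C *: z).
Hypothesis Utorus : forall (rho : R) z, (forall k, nm (z ord0 k) = rho) -> U z.
Hypothesis s00 : 0 < s0.
Hypothesis Udisc : forall z, (forall k, nm (z ord0 k) <= s0) ->
  U z /\ nm (g z) <= B0.
Hypothesis gU : forall z, U z -> line_diff g z.

Let line w : R[i] -> R[i] := fun c => g (c *: w).

Lemma line_punctured_hol w (r : R) : (forall c, nm c < r -> U (c *: w)) -> 0 < r ->
  punctured_hol r (line w).
Proof.
move=> wU r0; have dl c : nm c < r -> differentiable (line w) c.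
  move=> cr; rewrite (_ : line w = (fun t : R[i] => g (0 + t *: w))); last first.
    by apply/funext => t; rewrite add0r.
  by apply: (gU (wU c cr)); rewrite add0r.
split=> [z /andP[_]|]; first exact: dl.
by apply/differentiable_ccont/dl; rewrite nm0.
Qed.

(** Homogeneity of degree [d] in the direction, with the radius rescaled so that both integrals run
    over the same points. *)
Lemma coef_scale w d (t r R0 : R) : punctured_hol R0 (line w) -> 0 < t -> 0 < t * r < R0 ->
  coef (line (t%:C *: w)) d r = t%:C ^+ d * coef (line w) d (t * r).
Proof.
move=> wh t0 trR; have tn : t%:C != 0 by rewrite -nm_gt0 nm_real normr_gt0 gt_eqF.
rewrite /coef -(avgZ _ (@coef_cont R _ _ wh d _ trR)) /avg; congr (_ * _).
apply: eq_cint => x _; rewrite rmorphM /= -mulrA.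
move: (r%:C * cis x) => z; rewrite /line scalerA [z * _]mulrC.
move: (g _) => G; rewrite invfM exprMn (exprVn t%:C) [RHS]mulrCA; congr (_ * _).
by rewrite [RHS]mulrA mulfV ?mul1r// expf_neq0.
Qed.

Lemma coef_torus rho B w d (r : R) : 0 < rho -> 0 < r ->
  (forall z, (forall k, nm (z ord0 k) = rho) -> nm (g z) <= B) ->
  (forall k, nm (w ord0 k) * r = rho) -> nm (coef (line w) d r) * r ^+ d <= 2 * B.
Proof.
move=> rho0 r0 gB wr.
have wk k : nm (w ord0 k) = rho / r by rewrite -(wr k) mulfK ?gt_eqF.
have wU c : U (c *: w).
  by apply: (Utorus (rho := nm c * (rho / r))) => k; rewrite mxE nmM wk.
apply: (@coef_bound R _ (r + 1)).
- by apply: line_punctured_hol => //; lra.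
- by rewrite r0; lra.
move=> z zr; apply: gB => k; rewrite mxE nmM zr wk mulrCA mulfV ?mulr1// gt_eqF//.
Qed.

(** The maximum principle holds for the approximations [root_avg], and [N] tends to infinity. Radius
    2 is beyond the roots of unity, as [root_avgP] requires, and [4 * s <= s0] keeps lines up to
    radius 4 in the polydisc where [g] is bounded. *)
Lemma coef_polydisc (K : R) d s : 0 < s -> 4 * s <= s0 ->
  (forall z, (forall k, nm (z ord0 k) = s) -> nm (coef (line z) d 2) <= K) ->
  forall w, (forall k, nm (w ord0 k) <= s) -> nm (coef (line w) d 2) <= K.
Proof.
move=> sp ss HK w ws.
have inU z c : (forall k, nm (z ord0 k) <= s) -> nm c <= 4 ->
    U (c *: z) /\ nm (line z c) <= B0.
  move=> zs c4; apply: Udisc => k; rewrite mxE nmM.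
  by apply: le_trans ss; apply: ler_pM => //; exact: nm_ge0.
have ph z : (forall k, nm (z ord0 k) <= s) -> punctured_hol 4 (line z).
  move=> zs; apply: line_punctured_hol => // c c4; exact: (inU z c zs (ltW c4)).1.
pose err (N : nat) : R := 4 * B0 * (2^-1) ^+ N.
have AP z N : (forall k, nm (z ord0 k) <= s) -> (d < N)%N ->
    nm (root_avg (line z) N d - coef (line z) d 2) <= err N.
  move=> zs dN; have := @root_avgP (line z) 4 2 B0 N d (ph z zs).
  rewrite ltr1n ltr_nat => /(_ isT isT dN) H.
  have -> : err N = 2 * B0 * (2^-1) ^+ N * (2 / (2 - 1)).
    by rewrite /err (_ : (2 - 1 : R) = 1) ?invr1; [ring|ring].
  by apply: H => c c2; apply: (inU z c zs _).2; rewrite c2; lra.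
(* The approximation error is paid twice, once on the torus and once at [w]. *)
have AB N : (d < N)%N -> nm (coef (line w) d 2) <= K + 2 * err N.
  move=> dN.
  have A1 : nm (root_avg (line w) N d) <= K + err N.
    apply: (@polydisc_max (fun z => root_avg (line z) N d) s) => //.
      move=> z zs u v c uc.
      apply: diffC_M; first exact: diffC_cst.
      pose h (j : nat) (t : R[i]) := line (u + t *: v) (unity_root N ^+ j) *
        (unity_root N ^+ j)^-1 ^+ d.
      apply: (@diffC_sum N h) => j _.
      apply: diffC_M; last exact: diffC_cst.
      set x := unity_root N ^+ j.
      rewrite /line (_ : (fun _ => _) =
        (fun t : R[i] => g (x *: u + t *: (x *: v)))); last first.
        by apply/funext => t; rewrite scalerDr !scalerA [x * t]mulrC.
      have xU : U (x *: z).
        apply: (Udisc _).1 => k; rewrite mxE nmM /x nmX nm_cis expr1n mul1r.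
        by apply: le_trans (ltW (zs k)) _; lra.
      by apply: (gU xU); rewrite -uc scalerDr !scalerA [x * c]mulrC.
    move=> z zs; have zs' k : nm (z ord0 k) <= s by rewrite zs.
    rewrite -[root_avg _ _ _](subrK (coef (line z) d 2)).
    apply: (le_trans (nmD _ _)); rewrite addrC; apply: lerD; first exact: HK.
    exact: AP.
  have -> : coef (line w) d 2 = root_avg (line w) N d -
    (root_avg (line w) N d - coef (line w) d 2) by rewrite subKr.
  apply: (le_trans (nmB _ _)); have := AP w N ws dN; lra.
apply/ler_addgt0Pr => e e0.
have h01 : 0 <= (2^-1 : R) < 1 by lra.
have [N NP] := geom_small (2 * (4 * B0) * (2^-1) ^+ d.+1) h01 e0.
have := AB (d.+1 + N)%N ltac:(by rewrite leq_addr).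
move=> /le_trans; apply; rewrite lerD2l; apply: le_trans NP.
by rewrite /err exprD !mulrA.
Qed.

Lemma sum_half (B : R) N : \sum_(d < N) B * (2^-1) ^+ d = 2 * B * (1 - (2^-1) ^+ N).
Proof.
elim: N => [|N IH]; first by rewrite big_ord0 expr0 subrr mulr0.
by rewrite big_ord_recr /= IH exprS; field.
Qed.

(** On the torus of radius [s] Cauchy's inequality gives [2 * B * (s / rho) ^+ d]. This holds on the
    whole polydisc of radius [s], which contains [w] scaled by [2 * s / rho]. Homogeneity then gives
    [2 * B * (2^-1) ^+ d] for [w], and the geometric series doubles this to [4 * B]. *)
Theorem torus_bound rho B w : 0 < rho ->
  (forall z, (forall k, nm (z ord0 k) = rho) -> nm (g z) <= B) ->
  U w -> (forall k, nm (w ord0 k) <= rho / 2) -> nm (g w) <= 4 * B.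
Proof.
move=> rho0 gB Uw wr.
have B_ge0 : 0 <= B.
  apply: le_trans (gB (const_mx rho%:C) _); first exact: nm_ge0.
  by move=> k; rewrite mxE nm_real gtr0_norm.
pose s := Num.min s0 rho / 4.
have m0 : 0 < Num.min s0 rho by rewrite lt_min s00.
have ms : Num.min s0 rho <= s0 by rewrite ge_min lexx.
have mr : Num.min s0 rho <= rho by rewrite ge_min lexx orbT.
have sp : 0 < s by rewrite divr_gt0.
have ss : 4 * s <= s0 by rewrite /s; lra.
have sr : 4 * s <= rho by rewrite /s; lra.
have KT d z : (forall k, nm (z ord0 k) = s) ->
    nm (coef (line z) d 2) <= 2 * B * (s / rho) ^+ d.
  move=> zs; have r0 : 0 < rho / s by rewrite divr_gt0.
  have zU c : U (c *: z).
    by apply: (Utorus (rho := nm c * s)) => k; rewrite mxE nmM zs.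
  have ph : punctured_hol (rho / s + 1) (line z) by apply: line_punctured_hol => //; lra.
  have r2 : 2 <= rho / s by rewrite ler_pdivlMr//; lra.
  rewrite (coef_radius ph d _ r2); [|lra|lra].
  have -> : s / rho = (rho / s)^-1 by rewrite invf_div.
  rewrite exprVn ler_pdivlMr ?exprn_gt0//.
  apply: (coef_torus d rho0 r0 gB) => k.
  by rewrite zs mulrCA mulfV ?mulr1 ?gt_eqF.
have [t t1 tU] := Uopen Uw.
have wU c : nm c < t -> U (c *: w).
  move=> ct; have -> : c *: w = (c * t^-1%:C) *: (t%:C *: w).
    rewrite scalerA -mulrA -rmorphM mulVf ?rmorph1 ?mulr1// gt_eqF//; lra.
  apply: Ubal => //; rewrite nmM nm_real ger0_norm ?invr_ge0; last lra.
  by rewrite ler_pdivrMr ?mul1r; [exact: ltW|lra].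
have phw : punctured_hol t (line w) by apply: line_punctured_hol => //; lra.
(* The value at [w] is the value of the line at parameter 1, so the Taylor estimate needs a radius
   strictly between 1 and [t]. *)
pose r := (1 + t) / 2.
have r1 : 1 < r by rewrite /r; lra.
have rt : r < t by rewrite /r; lra.
have q0 : 0 < 2 * s / rho by rewrite divr_gt0 ?mulr_gt0.
have q1 : 2 * s / rho * 2 <= 1 by rewrite mulrAC ler_pdivrMr//; lra.
have Kw d : nm (coef (line w) d r) <= 2 * B * (2^-1) ^+ d.
  have h2 : 0 < 2 * s / rho * 2 < t by apply/andP; split; [rewrite mulr_gt0|lra].
  have rr : 2 * s / rho * 2 <= r by lra.
  rewrite -(coef_radius phw d _ rr rt); last by case/andP: h2.
  have := coef_polydisc sp ss (KT d) (w := (2 * s / rho)%:C *: w).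
  rewrite (coef_scale d phw q0 h2) nmM nmX nm_real (gtr0_norm q0) => H.
  have q0d : 0 < (2 * s / rho) ^+ d by rewrite exprn_gt0.
  rewrite -(ler_pM2l q0d); apply: le_trans (H _) _.
    move=> k; rewrite mxE nmM nm_real (gtr0_norm q0).
    apply: (le_trans (ler_wpM2l (ltW q0) (wr k))).
    suff -> : 2 * s / rho * (rho / 2) = s by [].
    by field; rewrite gt_eqF.
  suff -> : (2 * s / rho) ^+ d * (2 * B * (2^-1) ^+ d) = 2 * B * (s / rho) ^+ d by [].
  rewrite mulrCA -exprMn; congr (_ * _ ^+ _).
  by field; rewrite gt_eqF.
have [C C0 CP] := circle_bounded phw (r := r) ltac:(by rewrite rt andbT; lra).
apply/ler_addgt0Pr => e e0.
have x01 : 0 <= r^-1 < 1 by rewrite invr_ge0 invf_lt1; lra.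
have [N NP] := geom_small (2 * C * (r / (r - 1))) x01 e0.
have := @taylor R _ _ phw r 1 C N ltac:(by rewrite nm1) rt CP.
rewrite nm1 mul1r => T.
have -> : g w = (line w 1 - \sum_(d < N) coef (line w) d r * 1 ^+ d) +
    \sum_(d < N) coef (line w) d r * 1 ^+ d by rewrite subrK /line scale1r.
apply: (le_trans (nmD _ _)); rewrite addrC; apply: lerD; last first.
  by apply: le_trans T _; apply: le_trans NP; rewrite mulrAC.
apply: (le_trans (nm_sum _ _ _)).
apply: (@le_trans _ _ (\sum_(d < N) 2 * B * (2^-1) ^+ d)).
  by apply: ler_sum => d _; rewrite expr1n mulr1.
rewrite sum_half; have : 0 <= (2^-1 : R) ^+ N by rewrite exprn_ge0// invr_ge0.
move: (_ ^+ N) => y y0; have : 0 <= B * y by rewrite mulr_ge0.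
lra.
Qed.

End TorusBound.
End SeveralVariables.

(** * Entire functions and polynomials *)

Local Opaque coef.

Section Entire.
Variable R : realType.
Implicit Types (f : R[i] -> R[i]) (z a : R[i]) (p q : {poly R[i]}).

Lemma entire_punctured_hol f (R0 : R) : (forall z, differentiable f z) -> punctured_hol R0 f.
Proof. by move=> df; split=> [z _|]; [|apply: differentiable_ccont]. Qed.

(** Cauchy's inequality on arbitrarily large circles kills every coefficient of index above [m]. *)
Lemma entire_poly_growth f (m : nat) (C R1 : R) :
  (forall z, differentiable f z) ->
  (forall z, R1 <= nm z -> nm (f z) <= C * nm z ^+ m) ->
  exists p, forall z, f z = p.[z].
Proof.
move=> df fC.
have ce d (r : R) : 1 <= r -> coef f d r = coef f d 1.
  move=> r1; symmetry; apply: (coef_radius (entire_punctured_hol (r + 1) df)); lra.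
have c0 d : (m < d)%N -> coef f d 1 = 0.
  move=> md; apply/eqP; rewrite -nm_eq0 eq_le nm_ge0 andbT.
  apply/ler_addgt0Pr => e e0; rewrite add0r.
  pose r := Num.max (Num.max 1 R1) (2 * C / e).
  have r1 : 1 <= r by rewrite !le_max lexx.
  have rR : R1 <= r by rewrite !le_max lexx orbT.
  have rC : 2 * C / e <= r by rewrite !le_max lexx orbT.
  have r0 : 0 < r by lra.
  rewrite -(ce d r r1).
  have := @coef_bound R f (r + 1) (entire_punctured_hol (r + 1) df) d r (C * r ^+ m).
  move=> /(_ ltac:(by rewrite r0; lra)) H.
  have {}H : nm (coef f d r) * r ^+ d <= 2 * (C * r ^+ m).
    by apply: H => z zr; rewrite -zr fC// zr.
  have rm : 0 < r ^+ m by rewrite exprn_gt0.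
  have {}H : nm (coef f d r) * r ^+ (d - m) <= 2 * C.
    rewrite -(ler_pM2r rm) -mulrA -exprD subnK; last exact: ltnW.
    by rewrite -mulrA.
  have rd : r <= r ^+ (d - m).
    rewrite -{1}[r]expr1; apply: ler_weXn2l => //; by rewrite subn_gt0.
  move: rC; rewrite ler_pdivrMr// => rC.
  have := ler_wpM2l (nm_ge0 (coef f d r)) rd => H2.
  by rewrite -(ler_pM2r r0) [e * r]mulrC; lra.
exists (\poly_(d < m.+1) coef f d 1) => z; rewrite horner_poly.
pose r := nm z + 1; have z0 := nm_ge0 z.
have zr : nm z < r by rewrite /r; lra.
have r1 : 1 <= r by rewrite /r; lra.
have rr : 0 < r < r + 1 by apply/andP; split; lra.
have ph := entire_punctured_hol (r + 1) df.
have [B _ BP] := circle_bounded ph rr.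
apply/eqP; rewrite -subr_eq0; apply/eqP.
have q01 : 0 <= nm z / r < 1.
  by rewrite divr_ge0 ?(le_trans _ r1)//= ltr_pdivrMr ?mul1r//; lra.
apply: (@geom_eq0 R _ (2 * B * (nm z / r) ^+ m.+1 * (r / (r - nm z))) _ q01) => k.
have := @taylor R _ _ ph r z B (m.+1 + k) zr ltac:(by lra) BP.
have -> : \sum_(d < m.+1 + k) coef f d r * z ^+ d =
    \sum_(d < m.+1) coef f d 1 * z ^+ d.
  rewrite big_split_ord /= [X in _ + X]big1 ?addr0.
    by apply: eq_bigr => d _; rewrite (ce _ r r1).
  by move=> d _; rewrite (ce _ r r1) c0 ?mul0r// addSn ltnS leq_addr.
move=> /le_trans; apply; rewrite exprD.
by rewrite [2 * B * (_ * _)]mulrA mulrAC.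
Qed.

(** The function [l] given by 1 / f(1 / w) tends to 0 at 0 and does not vanish nearby otherwise, so
    it has a zero of finite order [m]. The lower bound of [l] by half its leading term is the upper
    bound sought for [f]. *)
Lemma entire_proper_growth f : (forall z, differentiable f z) ->
  (forall K : R, exists R0 : R, forall z, R0 <= nm z -> K <= nm (f z)) ->
  exists m : nat, exists C R1 : R,
    forall z, R1 <= nm z -> nm (f z) <= C * nm z ^+ m.
Proof.
move=> df fp.
have [R0' R0P'] := fp 1; pose R0 := Num.max 1 R0'.
have R01 : 1 <= R0 by rewrite /R0 le_max lexx.
have R0P z : R0 <= nm z -> 1 <= nm (f z).
  by move=> zR; apply: R0P'; apply: le_trans zR; rewrite /R0 le_max lexx orbT.
have R00 : 0 < R0 by lra.
(* The factor [w / w] only forces the value [0] at [w = 0]. *)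
pose l (w : R[i]) := w / w * (f w^-1)^-1.
have lE w : w != 0 -> l w = (f w^-1)^-1 by move=> w0; rewrite /l mulfV ?mul1r.
have l0 : l 0 = 0 by rewrite /l mul0r mul0r.
have fn w : 0 < nm w < R0^-1 -> 1 <= nm (f w^-1).
  move=> /andP[w0 wR]; apply: R0P; rewrite nmV -[R0]invrK lef_pV2 ?posrE ?invr_gt0//.
  exact: ltW.
have lh : punctured_hol R0^-1 l.
  split=> [w /[dup] wR /andP[w0 _]|].
    have wn : w != 0 by rewrite -nm_gt0.
    have di : differentiable (fun w : R[i] => w^-1) w.
      by apply: diffC_V; [exact: differentiable_idC|].
    apply: diffC_M; first by apply: diffC_M; [exact: differentiable_idC|].
    apply: diffC_V; last by rewrite -nm_gt0 (lt_le_trans ltr01 (fn w wR)).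
    exact: (differentiable_comp di (df _)).
  move=> e e0; have [X XP] := fp (2 / e).
  have X1 : 0 < `|X| + 1 by rewrite ltr_wpDl.
  exists (`|X| + 1)^-1; first by rewrite invr_gt0.
  move=> w; rewrite subr0 l0 subr0 => wX.
  have [->|wn] := eqVneq w 0; first by rewrite l0 nm0.
  have w0 : 0 < nm w by rewrite nm_gt0.
  rewrite lE// nmV.
  have K : 2 / e <= nm (f w^-1).
    apply: XP; rewrite nmV; apply: (@le_trans _ _ (`|X| + 1)).
      by have := ler_norm X; lra.
    by rewrite -[_ + 1]invrK lef_pV2 ?posrE ?invr_gt0// ltW.
  have e2 : 0 < 2 / e by rewrite divr_gt0.
  apply: (@le_lt_trans _ _ (2 / e)^-1).
    by rewrite lef_pV2 ?posrE// (lt_le_trans e2).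
  by rewrite invf_div; lra.
pose r := R0^-1 / 2.
have i0 : 0 < R0^-1 by rewrite invr_gt0.
have r0 : 0 < r by rewrite divr_gt0.
have rR : r < R0^-1 by rewrite /r; lra.
have [B B0 BP] := circle_bounded lh (r := r) ltac:(by rewrite r0).
(* Otherwise the Taylor estimate would make [l] vanish at [r / 2], where it is the inverse of a
   nonzero number. *)
have ex : exists d, coef l d r != 0.
  apply: contrapT => nex.
  have c0 d : coef l d r = 0.
    by apply/eqP; apply: contrapT => /negP H; apply: nex; exists d.
  pose a : R[i] := (r / 2)%:C.
  have na : nm a = r / 2 by rewrite nm_real gtr0_norm// divr_gt0.
  have la : l a = 0.
    have q01 : 0 <= nm a / r < 1.
      have -> : nm a / r = 1 / 2 by rewrite na; field; rewrite gt_eqF.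
      lra.
    apply: (@geom_eq0 R _ (2 * B * (r / (r - nm a))) _ q01) => n.
    have := @taylor R _ _ lh r a B n ltac:(by rewrite na; lra) rR BP.
    rewrite big1 ?subr0; first by move=> /le_trans; apply; rewrite mulrAC.
    by move=> d _; rewrite c0 mul0r.
  have an : a != 0 by rewrite -nm_gt0 na divr_gt0.
  have := fn a; rewrite na => /(_ ltac:(by apply/andP; split; lra)).
  move: la; rewrite lE// => /eqP; rewrite invr_eq0 => /eqP ->.
  by rewrite nm0; lra.
pose m := ex_minn ex.
have cm : coef l m r != 0 by rewrite /m; case: ex_minnP.
have cd d : (d < m)%N -> coef l d r = 0.
  rewrite /m; case: ex_minnP => k _ kmin dk; apply/eqP.
  by apply: contraTT dk => /kmin; rewrite -leqNgt.
set c := coef l m r in cm; have nc : 0 < nm c by rewrite nm_gt0.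
(* [2 * B] comes from [taylor], and [r / (r - nm a)] is at most 2 when [nm a <= r / 2]. Then [dl]
   makes the remainder at most half the leading term. *)
pose K := 4 * B / r ^+ m.+1.
have K0 : 0 <= K by rewrite divr_ge0 ?mulr_ge0// exprn_ge0// ltW.
pose dl := Num.min (r / 2) (nm c / (2 * (K + 1))).
have dl0 : 0 < dl.
  rewrite lt_min; apply/andP; split; first lra.
  by rewrite divr_gt0// mulr_gt0//; lra.
have dl1 : dl <= r / 2 by rewrite /dl ge_min lexx.
have dl2 : dl * (2 * (K + 1)) <= nm c.
  by rewrite -ler_pdivlMr ?mulr_gt0//; [rewrite /dl ge_min lexx orbT|lra].
exists m, (2 / nm c), dl^-1 => z zd.
have z0 : 0 < nm z by apply: lt_le_trans zd; rewrite invr_gt0.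
have zn : z != 0 by rewrite -nm_gt0.
pose a := z^-1.
have an : a != 0 by rewrite invr_eq0.
have a0 : 0 < nm a by rewrite nm_gt0.
have ad : nm a <= dl.
  by rewrite /a nmV -[dl]invrK lef_pV2 ?posrE ?invr_gt0.
have ra : nm a <= r / 2 by exact: le_trans ad dl1.
have ar : nm a < r by apply: (le_lt_trans ra); rewrite ltr_pdivrMr// ltr_pMr// ltr1n.
have := @taylor R _ _ lh r a B m.+1 ar rR BP.
rewrite big_ord_recr /= big1 ?add0r; last by move=> d _; rewrite cd ?mul0r.
rewrite -/c => T.
have {}T : nm (l a - c * a ^+ m) <= K * nm a ^+ m.+1.
  apply: (le_trans T); rewrite expr_div_n /K.
  have k2 : r / (r - nm a) <= 2.
    by clear -r0 ra; move: r (nm a) r0 ra => u v u0 vu; rewrite ler_pdivrMr; lra.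
  have am : 0 <= nm a ^+ m.+1 by rewrite exprn_ge0// ltW.
  have rm : 0 < r ^+ m.+1 by rewrite exprn_gt0.
  have p0 : 0 <= 2 * B * (nm a ^+ m.+1 / r ^+ m.+1).
    exact: mulr_ge0 (mulr_ge0 (ler0n _ 2) B0) (divr_ge0 am (ltW rm)).
  apply: (le_trans (ler_wpM2l p0 k2)).
  suff -> : 2 * B * (nm a ^+ m.+1 / r ^+ m.+1) * 2 =
     4 * B / r ^+ m.+1 * nm a ^+ m.+1 by [].
  clear -rm; move: (nm a ^+ m.+1) (r ^+ m.+1) rm => u v v0.
  by field; rewrite gt_eqF.
have am : 0 < nm a ^+ m by rewrite exprn_gt0.
have L : nm c / 2 * nm a ^+ m <= nm (l a).
  have W : K * nm a ^+ m.+1 <= nm c / 2 * nm a ^+ m.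
    rewrite exprS mulrA ler_wpM2r// ?(ltW am)//.
    have : K * nm a <= K * dl by rewrite ler_wpM2l.
    clear -dl2 dl0; move: (nm c) (nm a) K dl dl2 dl0 => x y k d d2 d0 kd; lra.
  have U : nm c * nm a ^+ m - nm (l a) <= nm c / 2 * nm a ^+ m.
    apply: le_trans W; apply: le_trans T.
    by rewrite nmBC -nmX -nmM; exact: nm_triangle_sub.
  have -> : nm c / 2 * nm a ^+ m = nm c * nm a ^+ m - nm c / 2 * nm a ^+ m.
    by rewrite -mulrBl; congr (_ * _); clear; move: (nm c) => x; field.
  by rewrite lerBlDr addrC -lerBlDr.
have f0 : 0 < nm (f z).
  have aR : 0 < nm a < R0^-1 by rewrite a0 (lt_trans ar rR).
  by rewrite -[z]invrK; exact: lt_le_trans ltr01 (fn a aR).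
have p0 : 0 < nm c / 2 * nm a ^+ m by rewrite mulr_gt0// divr_gt0.
move: L; rewrite (lE _ an) nmV {1}/a invrK => L.
have -> : 2 / nm c * nm z ^+ m = (nm c / 2 * nm a ^+ m)^-1.
  by rewrite invfM invf_div /a nmV exprVn invrK.
by rewrite -[nm (f z)]invrK lef_pV2 ?posrE ?invr_gt0.
Qed.

Lemma poly_vanish_infty p :
  (forall e : R, 0 < e -> exists X : R, forall x : R, X <= x -> nm p.[x%:C] <= e) ->
  p = 0.
Proof.
elim/poly_ind: p => [//|p c IH] H.
have p0 : p = 0.
  apply: IH => e e0; have [X XP] := H e e0.
  have nc := nm_ge0 c.
  exists (Num.max (Num.max X 1) ((e + nm c) / e)) => x.
  rewrite !ge_max => /andP[/andP[/XP Hx x1]]; rewrite ler_pdivrMr// => xe.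
  have xn : x%:C != 0 by rewrite -nm_gt0 nm_real normr_gt0; lra.
  have x0 : 0 < x by lra.
  have -> : p.[x%:C] = ((p * 'X + c%:P).[x%:C] - c) / x%:C.
    by rewrite !hornerE addrK mulfK.
  rewrite nmM nmV nm_real gtr0_norm// ler_pdivrMr//.
  by apply: (le_trans (nmB _ _)); lra.
rewrite p0 mul0r add0r; suff -> : c = 0 by rewrite polyC0.
apply/eqP; rewrite -nm_eq0 eq_le nm_ge0 andbT.
apply/ler_addgt0Pr => e e0; rewrite add0r; have [X XP] := H e e0.
by have := XP X (lexx X); rewrite p0 mul0r add0r hornerC.
Qed.

Lemma conj_horner p z : (p.[z])^*%C = (map_poly conjc p).[z^*%C].
Proof. exact: esym (horner_map _ _ _). Qed.

Lemma sqr_nmC z : (nm z ^+ 2)%:C = z * z^*%C.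
Proof. by rewrite rmorphXn /= -nmE sqr_normc. Qed.

(* Polarization: a polynomial in [z] and its conjugate that vanishes at infinity
   is zero, even when the two variables are separated. *)
Lemma poly_modulus_proportional p q (z0 : R[i]) : p.[z0] != 0 ->
  (forall e : R, 0 < e -> exists X : R, forall z, X <= nm z ->
     `|nm q.[z] ^+ 2 - nm p.[z] ^+ 2| <= e) ->
  exists k, forall z, q.[z] = k * p.[z].
Proof.
move=> pz0 H; pose pc := map_poly conjc p; pose qc := map_poly conjc q.
(* For real [x] and [y] the points x + iy and x - iy are conjugate, so [P ('i * y%:C)] at [x] is the
   difference of squared moduli at x + iy, and it is a polynomial in [x] that tends to 0. *)
pose P (y : R[i]) := (q \Po ('X + y%:P)) * (qc \Po ('X - y%:P)) -
  (p \Po ('X + y%:P)) * (pc \Po ('X - y%:P)).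
have PE y x : (P y).[x] = q.[x + y] * qc.[x - y] - p.[x + y] * pc.[x - y].
  by rewrite !hornerE !horner_comp !hornerE.
have Preal (x y : R) : (P ('i * y%:C)).[x%:C] =
   (nm q.[x%:C + 'i * y%:C] ^+ 2 - nm p.[x%:C + 'i * y%:C] ^+ 2)%:C.
  rewrite rmorphB /= !sqr_nmC !conj_horner PE.
  suff -> : (x%:C + 'i * y%:C)^*%C = x%:C - 'i * y%:C by [].
  by simpc.
have P0 (y : R) : P ('i * y%:C) = 0.
  apply: poly_vanish_infty => e /H[X XP]; exists X => x Xx.
  rewrite Preal nm_real; apply: XP; apply: (le_trans Xx).
  apply: (le_trans (ler_norm x)); have := nm_ge_Re (x%:C + 'i * y%:C).
  by rewrite ReD ReM /= mul0r mulr0 subr0 addr0.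
(* The roles are exchanged: for any complex [x], this polynomial in [y] vanishes on the nonnegative
   reals and hence identically. *)
pose Q (x : R[i]) := (q \Po (x%:P + 'i *: 'X)) * (qc \Po (x%:P - 'i *: 'X)) -
  (p \Po (x%:P + 'i *: 'X)) * (pc \Po (x%:P - 'i *: 'X)).
have QE x y : (Q x).[y] = (P ('i * y)).[x].
  by rewrite PE !hornerE !horner_comp !hornerE.
have Q0 x : Q x = 0.
  apply: poly_vanish_infty => e e0; exists 0 => y _.
  by rewrite QE P0 horner0 nm0 ltW.
have sep z w : q.[z] * qc.[w] = p.[z] * pc.[w].
  pose x := (z + w) / 2; pose y := (z - w) / (2 * 'i).
  have i0 : ('i : R[i]) != 0 by rewrite -nm_gt0 nm_i.
  have := QE x y; rewrite Q0 horner0 PE => /esym/eqP; rewrite subr_eq0 => /eqP.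
  have -> : x + 'i * y = z by rewrite /x /y; field; rewrite i0.
  by have -> : x - 'i * y = w by rewrite /x /y; field; rewrite i0.
have qz0 : qc.[z0^*%C] != 0.
  have := sep z0 z0^*%C; apply: contra_eq_neq => ->.
  by rewrite mulr0 eq_sym mulf_neq0// -conj_horner conjc_eq0.
exists (pc.[z0^*%C] / qc.[z0^*%C]) => z.
by apply: (mulIf qz0); rewrite sep mulrAC mulfVK// mulrC.
Qed.

(** By injectivity [p - p.[a]] has [a] as its only root, so it is a monomial in z - a. Comparing
    this for [a = 0] and [a = 1] leaves only the exponent 1. *)
Lemma poly_inj_linear p : injective (horner p) ->
  exists b c, c != 0 /\ forall z, p.[z] = b + c * z.
Proof.
move=> pinj.
have fac a : exists l k, [/\ l != 0, (0 < k)%N &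
    forall z, p.[z] - p.[a] = l * (z - a) ^+ k].
  pose s := p - (p.[a])%:P; have sE z : s.[z] = p.[z] - p.[a] by rewrite !hornerE.
  have [r sr] := closed_field_poly_normal s.
  have s0 : s != 0.
    apply: contraTneq isT => s0; have := sE (a + 1); rewrite s0 horner0.
    move=> /esym/eqP; rewrite subr_eq0 => /eqP/pinj/eqP.
    by rewrite addrC -subr_eq0 addrK oner_eq0.
  have ra : all (pred1 a) r.
    apply/allP => x xr; apply/eqP/pinj/eqP; rewrite -subr_eq0 -sE sr hornerZ.
    by rewrite horner_prod (big_rem x)//= hornerXsubC subrr mul0r mulr0.
  have rE : r = nseq (size r) a by exact/all_pred1P.
  have zE z : s.[z] = lead_coef s * (z - a) ^+ size r.
    rewrite {1}sr hornerZ horner_prod rE size_nseq big_nseq.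
    congr (_ * _); elim: (size r) => [|k IH]; first by rewrite expr0.
    by rewrite iterS IH exprS !hornerE.
  exists (lead_coef s), (size r); split; rewrite ?lead_coef_eq0//.
    have := zE a; rewrite sE !subrr; case: (size r) => // /esym/eqP.
    by rewrite expr0 mulr1 lead_coef_eq0 (negPf s0).
  by move=> z; rewrite -sE zE.
have [l0 [d0 [l0n d0p p0]]] := fac 0.
have [l1 [d1 [l1n d1p p1]]] := fac 1.
have E z : l0 * z ^+ d0 - l1 * (z - 1) ^+ d1 = l0.
  have e1 := p0 1; rewrite subr0 expr1n mulr1 in e1.
  by rewrite -p1 -{1}[z]subr0 -p0 -e1; ring.
(* Evaluation at 0 and -1 eliminates [l1] and gives 2^d1 = 1 - (-1)^d0, which is 0 or 2. *)
have E0 := E 0; have EN := E (-1).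
rewrite expr0n gtn_eqF// mulr0 !sub0r in E0.
have d1E : (2 ^+ d1 : R[i]) = 1 - (-1) ^+ d0.
  apply: (mulfI l0n); rewrite mulrBr mulr1 -{2}EN -{1}E0.
  have -> : - 1 - 1 = - 1 * 2 :> R[i] by ring.
  by rewrite exprMn; ring.
have d11 : d1 = 1%N.
  move: d1E; case/boolP: (odd d0) => od; rewrite -signr_odd.
    rewrite od expr1 opprK (_ : 1 + 1 = 2 ^+ 1 :> R[i])// -!natrX => /eqP.
    by rewrite eqr_nat eqn_exp2l// => /eqP.
  rewrite (negPf od) expr0 subrr => /eqP; rewrite expf_eq0.
  by rewrite pnatr_eq0 andbF.
exists (p.[1] - l1), l1; split=> // z.
have := p1 z; rewrite d11 expr1 => /eqP; rewrite subr_eq => /eqP ->; ring.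
Qed.

End Entire.

(** * The domains *)

Section Domain.
Variables (R : realType) (m : nat) (a : R).
Hypothesis a0 : 0 < a.
Notation V := 'rV[R[i]]_m.+1.
Implicit Types (z w : V).

Lemma powR_le x y : 0 <= x -> x <= y -> x `^ a <= y `^ a.
Proof.
move=> x0 xy; apply: ge0_ler_powR => //; rewrite ?nnegrE ?(ltW a0)//.
exact: le_trans xy.
Qed.

Lemma sqmodE (x : R[i]) : sqmod x = nm x ^+ 2.
Proof. by rewrite sqr_nm. Qed.

(** Clearing the negative power turns the condition into a product of two factors that both increase
    when the point is scaled up. *)
Lemma DomP z : Dom m a z <-> forall k : 'I_m.+1, k != ord_max ->
  `|nm (z ord0 k) ^+ 2 - nm (z ord0 ord_max) ^+ 2|
    * (nm (z ord0 ord_max) ^+ 2 + 1) `^ a < 1.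
Proof.
have P x : 0 < (nm x ^+ 2 + 1) `^ a :> R.
  by rewrite powR_gt0// ltr_wpDl// sqr_ge0.
split=> H k kn; have := H k kn.
  by rewrite !sqmodE powRN -[_^-1]mul1r ltr_pdivlMr.
by rewrite !sqmodE powRN -[X in _ -> _ < X]mul1r ltr_pdivlMr.
Qed.

Lemma Dom_gap z k : Dom m a z ->
  `|nm (z ord0 k) ^+ 2 - nm (z ord0 ord_max) ^+ 2|
    * (nm (z ord0 ord_max) ^+ 2 + 1) `^ a < 1.
Proof.
move=> /DomP H; have [->|/H//] := eqVneq k ord_max.
by rewrite subrr normr0 mul0r ltr01.
Qed.

Lemma gap_scale (t u v : R) : 0 <= t <= 1 -> 0 <= v ->
  `|t * u - t * v| * (t * v + 1) `^ a <= `|u - v| * (v + 1) `^ a.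
Proof.
move=> /andP[t0 t1] v0; have tv : t * v <= v by rewrite ler_piMl.
have tv0 : 0 <= t * v by rewrite mulr_ge0.
rewrite -mulrBr normrM (ger0_norm t0); apply: ler_pM.
- by rewrite mulr_ge0.
- exact: powR_ge0.
- by rewrite ler_piMl.
- by apply: powR_le; lra.
Qed.

Lemma Dom_bal z c : Dom m a z -> nm c <= 1 -> Dom m a (c *: z).
Proof.
move=> /DomP H c1; apply/DomP => k /H; apply: le_lt_trans.
rewrite !mxE !nmM !exprMn; apply: gap_scale; last exact: sqr_ge0.
by rewrite sqr_ge0 expr_le1// nm_ge0.
Qed.

Lemma bernoulli_sub (d : R) n : 0 <= d <= 1 -> 1 - n%:R * d <= (1 - d) ^+ n.
Proof.
move=> /andP[d0 d1]; elim: n => [|n IH]; first by rewrite expr0 mul0r subr0.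
rewrite exprS; have d1' : 0 <= 1 - d by lra.
apply: le_trans (ler_wpM2l d1' IH); rewrite -natr1.
have : 0 <= n%:R * d * d by rewrite !mulr_ge0.
by move: (n%:R) => x; lra.
Qed.

(** Scaling by [t >= 1] multiplies each gap by at most [t ^+ M], where [M = 2 * N.+1] and the
    integer [N] bounds the exponent [a]; so [t ^+ M * y < 1] for the largest gap [y] suffices. *)
Lemma Dom_open z : Dom m a z -> exists2 t : R, 1 < t & Dom m a (t%:C *: z).
Proof.
move=> H; pose s := nm (z ord0 ord_max) ^+ 2.
have s0 : 0 <= s by exact: sqr_ge0.
have P0 : 0 <= (s + 1) `^ a by exact: powR_ge0.
pose x k := `|nm (z ord0 k) ^+ 2 - s| * (s + 1) `^ a.
pose y := \big[Num.max/0]_k x k.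
have xy k : x k <= y by exact: le_bigmax.
have y1 : y < 1 by apply: bigmax_lt => // k _; exact: Dom_gap.
have y0 : 0 <= y by apply: le_trans (xy ord_max); rewrite mulr_ge0.
pose N := (Num.truncn a).+1; have aN : a <= N%:R by apply/ltW/truncnS_gt.
pose M := (2 * N.+1)%N; have M0 : 0 < (M%:R : R) by rewrite ltr0n.
have M1 : 1 <= (M%:R : R) by rewrite ler1n.
(* Bernoulli's inequality then gives (1 - d)^M >= (1 + y) / 2 > y. *)
pose d := (1 - y) / (2 * M%:R).
have Md : M%:R * d = (1 - y) / 2 by rewrite /d; field; rewrite gt_eqF.
have d0 : 0 < d by rewrite divr_gt0 ?mulr_gt0//; lra.
have d1 : d <= 1 / 2.
  by have := ler_wpM2r (ltW d0) M1; rewrite mul1r; lra.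
have B : y < (1 - d) ^+ M.
  apply: lt_le_trans (bernoulli_sub M _); last by apply/andP; split; lra.
  by rewrite Md; lra.
pose t := (1 - d)^-1.
have e0 : 0 < 1 - d by lra.
have t1 : 1 < t by rewrite /t invf_gt1//; lra.
have tM : t ^+ M * y < 1.
  by rewrite /t exprVn mulrC ltr_pdivrMr ?exprn_gt0// mul1r.
exists t => //; apply/DomP => k _.
have t0 : 0 < t by lra.
rewrite !mxE !nmM nm_real (gtr0_norm t0) !exprMn -/s -mulrBr normrM.
pose u := t ^+ 2; have u1 : 1 <= u by rewrite exprn_ege1// ltW.
have u0 : 0 <= u by lra.
rewrite -/u (ger0_norm u0).
have h1 : (u * s + 1) `^ a <= u ^+ N * (s + 1) `^ a.
  apply: (@le_trans _ _ ((u * (s + 1)) `^ a)).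
    apply: powR_le; first exact: addr_ge0 (mulr_ge0 u0 s0) ler01.
    by rewrite mulrDr mulr1 lerD2l.
  rewrite powRM ?addr_ge0//; apply: ler_wpM2r => //.
  by rewrite -powR_mulrn//; exact: ler_powR.
apply: (@le_lt_trans _ _ (t ^+ M * x k)); last first.
  by apply: le_lt_trans tM; rewrite ler_wpM2l// exprn_ge0// ltW.
have -> : t ^+ M * x k = u * `|nm (z ord0 k) ^+ 2 - s| * (u ^+ N * (s + 1) `^ a).
  by rewrite /M /x exprM -/u exprS; ring.
exact: ler_wpM2l (mulr_ge0 u0 (normr_ge0 _)) _ _ h1.
Qed.

Lemma Dom_torus (rho : R) z : (forall k, nm (z ord0 k) = rho) -> Dom m a z.
Proof.
by move=> zr; apply/DomP => k _; rewrite !zr subrr normr0 mul0r ltr01.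
Qed.

Lemma Dom_disc : exists2 s : R, 0 < s & forall z,
  (forall k, nm (z ord0 k) <= s) -> Dom m a z.
Proof.
have p0 : 0 < (2 : R) `^ a by rewrite powR_gt0.
exists (Num.min (1 / 2) (2 `^ a)^-1); first by rewrite lt_min invr_gt0 p0 andbT; lra.
set s := Num.min _ _; have s1 : s <= 1 / 2 by rewrite /s ge_min lexx.
have s2 : s <= (2 `^ a)^-1 by rewrite /s ge_min lexx orbT.
have s0 : 0 < s by rewrite lt_min invr_gt0 p0 andbT; lra.
move=> z zs; apply/DomP => k _.
have sq j : 0 <= nm (z ord0 j) ^+ 2 <= s / 2.
  rewrite sqr_ge0 expr2; apply: (@le_trans _ _ (s * s)).
    by apply: ler_pM; rewrite ?nm_ge0.
  by rewrite ler_wpM2l ?(ltW s0)//; lra.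
have := sq k; have := sq ord_max; set u := _ ^+ 2; set v := _ ^+ 2.
move=> /andP[u0 us] /andP[v0 vs].
have h1 : (u + 1) `^ a <= 2 `^ a.
  by apply: powR_le; lra.
have h2 : `|v - u| <= s / 2 by rewrite ler_norml; lra.
apply: (@le_lt_trans _ _ (s / 2 * 2 `^ a)).
  by apply: ler_pM; rewrite ?powR_ge0.
have : s * 2 `^ a <= 1 by rewrite -ler_pdivlMr// div1r.
by rewrite mulrAC; lra.
Qed.

(** The last coordinate controls all the others, so growth and properness need to be studied for it
    alone. *)
Lemma Dom_le z k : Dom m a z -> nm (z ord0 k) <= nm (z ord0 ord_max) + 1.
Proof.
move=> /(Dom_gap k); set u := nm _; set v := nm _ => H.
have u0 : 0 <= u by exact: nm_ge0.
have v0 : 0 <= v by exact: nm_ge0.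
have v2 := sqr_ge0 v.
have P1 : 1 <= (v ^+ 2 + 1) `^ a.
  by have := @powR_le 1 (v ^+ 2 + 1) ler01; rewrite powR1; apply; lra.
have d1 : `|u ^+ 2 - v ^+ 2| <= 1.
  by apply: ltW; apply: le_lt_trans H; rewrite ler_peMr.
rewrite -(ler_pXn2r (ltn0Sn 1)) ?nnegrE; [|by []|by lra].
by move: d1; rewrite ler_norml sqrrD expr1n mulr1 mulr2n; lra.
Qed.

Lemma Dom_gap_small (e : R) : 0 < e -> exists K : R, forall z k,
  Dom m a z -> K <= nm (z ord0 ord_max) ->
  `|nm (z ord0 k) ^+ 2 - nm (z ord0 ord_max) ^+ 2| <= e.
Proof.
move=> e0; pose K := e^-1 `^ a^-1; exists (K + 1) => z k /(Dom_gap k).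
set u := nm _; set v := nm _ => H Kv.
have K0 : 0 <= K by exact: powR_ge0.
have Pe : e^-1 <= (v ^+ 2 + 1) `^ a.
  have -> : e^-1 = K `^ a.
    by rewrite /K -powRrM mulVf ?gt_eqF// powRr1// invr_ge0 ltW.
  apply: (powR_le K0).
  have : v <= v ^+ 2 by rewrite expr2 ler_peMr; lra.
  lra.
have := ler_wpM2l (normr_ge0 (u ^+ 2 - v ^+ 2)) Pe.
by move=> /le_lt_trans/(_ H); rewrite ltr_pdivrMr// mul1r => /ltW.
Qed.

End Domain.

(** * Biholomorphisms *)

Section TorusCompact.
Variables (R : realType) (n : nat).
Notation V := 'rV[R[i]]_n.
Implicit Types (g : V -> R[i]) (z w : V).

Lemma nbhs_rVP z (P : set V) : nbhs z P <-> exists2 d : R, 0 < d &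
  forall y : V, (forall k, nm (y ord0 k - z ord0 k) < d) -> P y.
Proof.
split.
  move=> /nbhs_ballP[e /= e0 eP].
  have er : e = (complex.Re e)%:C by rewrite RRe_real// gtr0_real.
  exists (complex.Re e); first by rewrite -ltcR -er.
  move=> y yz; apply: eP; split=> // i j; rewrite -ball_normE /ball_ /=.
  by rewrite nmE er ltcR nmBC ord1.
move=> [d d0 dP]; apply/nbhs_ballP; exists d%:C => /=; first by rewrite ltcR.
move=> y [_ yz]; apply: dP => k.
by have := yz ord0 k; rewrite -ball_normE /ball_ /= nmE ltcR nmBC.
Qed.

Lemma differentiable_near g z : differentiable g z -> forall e : R, 0 < e ->
  \forall y \near z, nm (g y - g z) < e.
Proof. by move=> /differentiable_continuous/cvgCP. Qed.

Lemma circle_compact (rho : R) : compact [set c : R[i] | nm c = rho].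
Proof.
have [r0|r0] := ltP rho 0.
  rewrite (_ : [set _ | _] = set0); first exact: compact0.
  by apply/seteqP; split => // c /= cr; have := nm_ge0 c; rewrite cr leNgt r0.
have -> : [set c : R[i] | nm c = rho] = (fun t => rho%:C * cis t) @` `[0, tau R].
  apply/seteqP; split=> [c /= cr|c /= [t _ <-]]; last by rewrite nm_rcis ger0_norm.
  have [c0|c0] := eqVneq c 0.
    exists 0; first by rewrite in_itv /= lexx ltW// tau_gt0.
    by move: cr; rewrite c0 nm0 => <-; rewrite mul0r.
  have rp : 0 < rho by rewrite -cr nm_gt0.
  have [t tt cE] := @cis_surj R (rho^-1%:C * c) ltac:(by
    rewrite nmM nm_real cr ger0_norm ?invr_ge0// mulVf ?gt_eqF).
  exists t; first by rewrite in_itv.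
  by rewrite -cE mulrA -rmorphM mulfV ?gt_eqF// rmorph1 mul1r.
apply: continuous_compact; last exact: segment_compact.
apply: continuous_subspaceT => t; apply/cvgCP => e e0.
have r1 : 0 < rho + 1 by rewrite ltr_wpDl.
have d1 : 0 < e / (rho + 1) by rewrite divr_gt0.
have /cvgCP/(_ _ d1) := @cont_cis R t; apply: filterS => x.
rewrite ltr_pdivlMr// -mulrBr nmM nm_real ger0_norm//; apply: le_lt_trans.
rewrite mulrC ler_wpM2l ?nm_ge0//; lra.
Qed.

Lemma torus_bounded g (rho : R) :
  (forall z, (forall k, nm (z ord0 k) = rho) -> differentiable g z) ->
  exists B : R, forall z, (forall k, nm (z ord0 k) = rho) -> nm (g z) <= B.
Proof.
move=> dg.
have K := @rV_compact R[i] n _ (fun _ => @circle_compact rho).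
have H : \forall B \near +oo, [set v : V | forall i,
    [set c : R[i] | nm c = rho] (v ord0 i)] `<=` [set z | nm (g z) <= B].
  move/compact_near_coveringP : K => cK.
  apply: (cK R (+oo)%R (fun B z => nm (g z) <= B) _) => z zr.
  have C := differentiable_near (dg z zr) ltr01.
  near=> y B.
  have h1 : nm (g y - g z) < 1 by near: y.
  have h2 : nm (g z) + 1 <= B.
    by near: B; apply: nbhs_pinfty_ge; exact: num_real.
  rewrite -[g y](subrK (g z)); apply: (le_trans (nmD _ _)); apply: le_trans h2.
  by rewrite [leRHS]addrC lerD2r ltW.
by have [B BP] := filter_ex H; exists B => z zr; exact: BP.
Unshelve. all: by end_near. Qed.

End TorusCompact.

Section Main.
Variables (R : realType) (m : nat).
Notation V := 'rV[R[i]]_m.+1.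

Lemma holomorphic_coord (U : set V) (F : V -> V) z k :
  holomorphic_on U F -> U z -> differentiable (fun z => F z ord0 k : R[i]) z.
Proof.
move=> h /h H.
rewrite (_ : (fun z => _) = (fun v : V => v ord0 k : R[i]) \o F)//.
apply: (differentiable_comp H); exact: (@differentiable_coord R[i] 1 m.+1).
Qed.

Lemma Dom_torus_bound a (g : V -> R[i]) (rho B : R) (w : V) : 0 < a -> 0 < rho ->
  (forall z, Dom m a z -> differentiable g z) ->
  (forall z : V, (forall k, nm (z ord0 k) = rho) -> nm (g z) <= B) ->
  Dom m a w -> (forall k, nm (w ord0 k) <= rho / 2) -> nm (g w) <= 4 * B.
Proof.
move=> a0 rho0 dg gB wD wr.
have [s s0 sD] := @Dom_disc R m a a0.
have D0 : Dom m a (0 : V) by apply: sD => k; rewrite mxE nm0 ltW.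
have /nbhs_rVP[d d0 dP] := differentiable_near (dg _ D0) ltr01.
pose s1 := Num.min s (d / 2).
have s10 : 0 < s1 by rewrite lt_min s0 divr_gt0.
apply: (@torus_bound R m.+1 (Dom m a) g s1 (nm (g 0) + 1) _ _ _ s10 _ _ rho B w rho0 gB wD wr).
- by move=> z c; exact: Dom_bal.
- by move=> z; exact: Dom_open.
- by move=> r z; exact: Dom_torus.
- move=> z zs; split.
    by apply: sD => k; apply: le_trans (zs k) _; rewrite /s1 ge_min lexx.
  rewrite -[g z](subrK (g 0)); apply: (le_trans (nmD _ _)).
  rewrite addrC lerD2l ltW//; apply: dP => k; rewrite [X in _ - X]mxE subr0.
  apply: (le_lt_trans (zs k)).
  have : s1 <= d / 2 by rewrite /s1 ge_min lexx orbT.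
  lra.
- by move=> p pD; apply: differentiable_line_diff; exact: dg.
Qed.

(** * Linearity of a biholomorphism *)

Section Biholomorphism.
Variables (a1 a2 : R) (F G : V -> V).
Hypothesis hm : (1 <= m)%N.
Hypotheses (a10 : 0 < a1) (a20 : 0 < a2).
Hypothesis Fh : holomorphic_on (Dom m a1) F.
Hypothesis Gh : holomorphic_on (Dom m a2) G.
Hypothesis FG : forall z, Dom m a1 z -> Dom m a2 (F z) /\ G (F z) = z.

Definition unimodular (theta : V) := forall k, nm (theta ord0 k) = 1.

Lemma unimodular_Dom theta c : unimodular theta -> Dom m a1 (c *: theta).
Proof.
by move=> th; apply: (@Dom_torus R m a1 (nm c)) => k; rewrite mxE nmM th mulr1.
Qed.

Lemma line_differentiable theta k c : unimodular theta ->
  differentiable (fun c : R[i] => F (c *: theta) ord0 k : R[i]) c.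
Proof.
move=> th; have D := unimodular_Dom c th.
have := differentiable_line_diff (holomorphic_coord k Fh D).
move=> /(_ 0 theta c (add0r _)).
rewrite (_ : (fun c => F (c *: theta) ord0 k) =
  (fun t : R[i] => F (0 + t *: theta) ord0 k))//.
by apply/funext => t; rewrite add0r.
Qed.

(* [G] is bounded on bounded parts of its domain, so the image of a complex line
   is unbounded along every sequence tending to infinity. *)
Lemma line_proper theta : unimodular theta -> forall K : R, exists R0 : R,
  forall c, R0 <= nm c -> K <= nm (F (c *: theta) ord0 ord_max).
Proof.
(* If the last coordinate of the image is below [K], all its coordinates are at most [|K| + 1],
   which is the [rho / 2] of the torus bound. *)
move=> th K; pose rho := 2 * (`|K| + 1).
have rho0 : 0 < rho by rewrite mulr_gt0// ltr_wpDl.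
pose g := fun w : V => G w ord0 ord_max : R[i].
have dg z : Dom m a2 z -> differentiable g z by exact: holomorphic_coord.
have [B BP] := @torus_bounded R m.+1 g rho (fun z zr => dg z (@Dom_torus R m a2 _ _ zr)).
(* The last coordinate of [G (F (c *: theta))] has modulus [nm c], so the torus bound for [G] would
   force [nm c <= 4 * B]. *)
exists (4 * B + 1) => c cB; rewrite leNgt; apply/negP => fK.
have [FD GF] := FG (unimodular_Dom c th).
have := Dom_torus_bound a20 rho0 dg BP FD.
rewrite /g GF mxE nmM th mulr1 => H.
suff : nm c <= 4 * B by lra.
apply: H => k; apply: (le_trans (Dom_le a20 k FD)).
have -> : rho / 2 = `|K| + 1 by rewrite /rho; field.
by rewrite lerD2r (le_trans (ltW fK))// ler_norm.
Qed.

Lemma line_image theta : unimodular theta ->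
  exists (k : 'I_m.+1 -> R[i]) b c, c != 0 /\
    forall x j, F (x *: theta) ord0 j = k j * (b + c * x).
Proof.
move=> th; pose f j := fun c : R[i] => F (c *: theta) ord0 j : R[i].
have df j c : differentiable (f j) c by exact: line_differentiable.
have fp := line_proper th.
have FD c := (FG (unimodular_Dom c th)).1.
have [d [C [R1 CP]]] := entire_proper_growth (df ord_max) fp.
(* The extra 1 in [Dom_le] is absorbed by [nm z ^+ d] once [nm z >= 1], which gives [C + 1]. *)
have poly j : exists p : {poly R[i]}, forall z, f j z = p.[z].
  apply: (@entire_poly_growth _ _ d (C + 1) (Num.max 1 R1) (df j)) => z.
  rewrite ge_max => /andP[z1 zR]; apply: (le_trans (Dom_le a20 j (FD z))).
  by rewrite mulrDl mul1r; apply: lerD; [exact: CP|exact: exprn_ege1].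
have [p pE] := poly ord_max.
have [z0 pz0] : exists z0, p.[z0] != 0.
  have [R0 RP] := fp 1; exists (`|R0|)%:C.
  rewrite -nm_gt0 -pE; apply: lt_le_trans ltr01 (RP _ _).
  by rewrite nm_real normr_id ler_norm.
have prop j : exists k, forall z, f j z = k * p.[z].
  have [q qE] := poly j.
  have [e e0|k kP] := poly_modulus_proportional (q := q) pz0; last first.
    by exists k => z; rewrite qE.
  have [K KP] := @Dom_gap_small R m a2 a20 e e0; have [X XP] := fp K.
  by exists X => z /XP Kz; rewrite -qE -pE; exact: KP.
have [k kP] := choice prop.
(* Every coordinate on the line is a multiple of [p], so equal values of [p] give equal images under
   [F]. *)
have pinj : injective (horner p).
  move=> x y xy; have E : F (x *: theta) = F (y *: theta).
    by apply/rowP => j; have := kP j x; have := kP j y; rewrite /f xy => -> ->.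
  have := (FG (unimodular_Dom x th)).2; rewrite E (FG (unimodular_Dom y th)).2.
  move=> /rowP/(_ ord_max); rewrite !mxE => /mulIf H; apply/esym/H.
  by rewrite -nm_gt0 th.
have [b [c [c0 pbc]]] := poly_inj_linear pinj.
by exists k, b, c; split=> // x j; rewrite -pbc -kP.
Qed.

Lemma fix_origin : F 0 = 0.
Proof.
(* All coordinates of [F] on the line share the affine factor, and hence its root. *)
have zero theta : unimodular theta -> exists x, F (x *: theta) = 0.
  move=> /line_image[k [b [c [c0 H]]]]; exists (- b / c).
  have e0 : b + c * (- b / c) = 0 by field.
  by apply/rowP => j; rewrite H e0 mulr0 mxE.
(* For [m >= 1] the first and last indices differ, so these two directions are independent; the
   common preimage of 0 lies on both lines. *)
pose t1 : V := const_mx 1; pose t2 : V := \row_j (if j == ord_max then 1 else -1).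
have u1 : unimodular t1 by move=> k; rewrite mxE nm1.
have u2 : unimodular t2 by move=> k; rewrite mxE; case: ifP; rewrite ?nmN nm1.
have [x1 X1] := zero _ u1; have [x2 X2] := zero _ u2.
have /rowP E : x2 *: t2 = x1 *: t1.
  by rewrite -(FG (unimodular_Dom x1 u1)).2 X1 -X2 (FG (unimodular_Dom x2 u2)).2.
have := E ord_max; have := E ord0; rewrite !mxE eqxx !mulr1.
rewrite ifN; last first.
  by apply/eqP => /(congr1 val) /=; move: hm => /[swap] <-.
rewrite mulrN1 => /[swap] -> /eqP; rewrite eq_sym -addr_eq0 -mulr2n mulrn_eq0 /=.
by move=> /eqP x0; rewrite -[RHS]X1 x0 scale0r.
Qed.

Lemma line_homogeneous theta x : unimodular theta ->
  F (x *: theta) = x *: F theta.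
Proof.
move=> /line_image[k [b [c [c0 H]]]]; apply/rowP => j; rewrite mxE.
have kb : k j * b = 0.
  by have := H 0 j; rewrite scale0r fix_origin mxE mulr0 addr0.
have := H 1 j; rewrite scale1r => ->; rewrite H.
rewrite !mulrDr kb !add0r; ring.
Qed.

Lemma biholomorphism_linear : exists A : 'M[R[i]]_m.+1,
  forall z, Dom m a1 z -> F z = z *m A.
Proof.
have D0 : Dom m a1 (0 : V).
  have [s s0 sD] := @Dom_disc R m a1 a10.
  by apply: sD => k; rewrite mxE nm0 ltW.
pose f j := fun z : V => F z ord0 j : R[i].
have df j z : Dom m a1 z -> differentiable (f j) z by exact: holomorphic_coord.
pose L j : {linear V -> R[i]} := 'd (f j) 0.
have Lcont j : continuous (L j) by exact: (diff_continuous (df j 0 D0)).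
have dscale (W : normedModType R[i]) (v : W) :
    'd (fun t : R[i] => t *: v) 0 1 = v.
  rewrite diffZl; last exact: differentiable_idC.
  have E : 'd (fun t : R[i] => t) 0 = (fun t => t) :> (_ -> _) by exact: diff_val.
  by rewrite E scale1r.
(* On the line F(t theta) = t F(theta); differentiating at t = 0 identifies F(theta) with the
   differential in the direction [theta]. *)
have LE theta j : unimodular theta -> f j theta = L j theta.
  move=> th; pose l := fun t : R[i] => t *: theta.
  have dl : differentiable l 0 by apply: differentiableZl; exact: differentiable_idC.
  have D : Dom m a1 (l 0) by exact: unimodular_Dom.
  have E2 : f j \o l = (fun t : R[i] => t *: f j theta).
    by apply/funext => t; rewrite /= /f /l line_homogeneous// mxE.
  have := diff_comp dl (df j _ D); rewrite E2 => /(congr1 (fun u => u 1)).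
  rewrite dscale => ->; rewrite /= dscale /L.
  by rewrite /l scale0r.
have LZ j c (v : V) : L j (c *: v) = c * L j v by rewrite linearZ_LR.
have Lsum j (z : V) : L j z = \sum_i z ord0 i * L j (delta_mx ord0 i).
  have := congr1 (L j) (row_sum_delta z); rewrite (linear_sum (L j)) => ->.
  by apply: eq_bigr => i _; rewrite LZ.
exists (\matrix_(i, j) L j (delta_mx ord0 i)) => z zD.
apply/rowP => j; rewrite [RHS]mxE (eq_bigr (fun i =>
  z ord0 i * L j (delta_mx ord0 i))); last by move=> i _; rewrite mxE.
rewrite -Lsum; apply/eqP; rewrite -subr_eq0 -nm_eq0 eq_le nm_ge0 andbT.
(* This gives the goal the form of the torus bound with [B = 0]: the difference between [F] and its
   differential vanishes on all tori. Below, [rho] makes [rho / 2] exceed every [nm (z ord0 k)]. *)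
rewrite -(mulr0 4).
pose rho := 2 * (\sum_k nm (z ord0 k) + 1).
have s0 : 0 <= \sum_k nm (z ord0 k) by apply: sumr_ge0 => k _; exact: nm_ge0.
have rho0 : 0 < rho by rewrite mulr_gt0// ltr_wpDl.
pose h := fun w : V => f j w - L j w.
apply: (@Dom_torus_bound a1 h rho 0 z a10 rho0 _ _ zD).
- move=> w wD; apply: differentiableB; first exact: df.
  exact: linear_differentiable.
- move=> w wr.
  have rn : rho%:C != 0 by rewrite -nm_gt0 nm_real normr_gt0 gt_eqF.
  pose theta := rho%:C^-1 *: w.
  have th : unimodular theta.
    by move=> k; rewrite mxE nmM wr nmV nm_real gtr0_norm// mulVf ?gt_eqF.
  have wE : w = rho%:C *: theta by rewrite scalerA mulfV// scale1r.
  rewrite /h wE /f line_homogeneous// mxE LZ -/(f j theta) LE//.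
  by rewrite subrr nm0.
- move=> k; have -> : rho / 2 = \sum_k nm (z ord0 k) + 1 by rewrite /rho; field.
  rewrite (bigD1 k)//= -addrA lerDl addr_ge0//; apply: sumr_ge0 => i _.
  exact: nm_ge0.
Qed.
End Biholomorphism.

Lemma biholomorphism_sym a1 a2 (F : V -> V) :
  biholomorphism (Dom m a1) (Dom m a2) F -> exists G,
  [/\ biholomorphism (Dom m a2) (Dom m a1) G,
      forall z, Dom m a1 z -> Dom m a2 (F z) /\ G (F z) = z &
      forall w, Dom m a2 w -> Dom m a1 (G w) /\ F (G w) = w].
Proof.
by move=> [Fh [G [Gh [GF FG]]]]; exists G; split=> //; split=> //; exists F.
Qed.

Theorem biholomorphic_linear (hm : (1 <= m)%N) (a1 a2 : R) (F : V -> V) :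
  0 < a1 -> 0 < a2 -> biholomorphism (Dom m a1) (Dom m a2) F ->
  exists A : 'M[R[i]]_m.+1, forall z, Dom m a1 z -> F z = z *m A.
Proof.
move=> a10 a20 [Fh [G [Gh [GF _]]]].
exact: (biholomorphism_linear hm a10 a20 Fh Gh GF).
Qed.

(** The inverse map is linear too, with matrix [B]. Small multiples of the basis vectors lie in the
    domain, which is enough to check that [A *m B] is the identity. *)
Theorem biholomorphic_linearly_equivalent (hm : (1 <= m)%N) (a1 a2 : R) (F : V -> V) :
  0 < a1 -> 0 < a2 -> biholomorphism (Dom m a1) (Dom m a2) F ->
  linearly_equivalent (Dom m a1) (Dom m a2 : set V).
Proof.
move=> a10 a20 FB; have [G [GB GF FG]] := biholomorphism_sym FB.
have [A AP] := biholomorphic_linear hm a10 a20 FB.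
have [B BP] := biholomorphic_linear hm a20 a10 GB.
have [s s0 sD] := @Dom_disc R m a1 a10.
have AB : A *m B = 1%:M.
  apply/row_matrixP => i; pose e : V := s%:C *: delta_mx ord0 i.
  have eD : Dom m a1 e.
    apply: sD => k; rewrite !mxE eqxx /= nmM nm_real (gtr0_norm s0).
    by case: (k == i); rewrite ?nm1 ?nm0 ?mulr1 ?mulr0 // ltW.
  have [FD GFe] := GF e eD.
  have : e *m (A *m B) = e by rewrite mulmxA -AP// -BP.
  rewrite -scalemxAl => /scalerI H; rewrite !rowE mulmx1; apply: H.
  by rewrite -nm_gt0 nm_real normr_gt0 gt_eqF.
exists A; split; first by have [] := mulmx1_unit AB.
apply/seteqP; split=> [_ [z zD <-]|w wD].
  by rewrite -AP//; case: (GF z zD).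
have [GD FGw] := FG w wD.
by exists (G w) => //; rewrite -AP.
Qed.

End Main.

Unset Implicit Arguments. Set Strict Implicit. Set Printing Implicit Defensive.
Local Close Scope complex_scope.

(* n = m.+1, so n >= 2 iff m >= 1, and n - 1 = m *)
Theorem theorem4p4 (R : realType) (m : nat) (hm : (1 <= m)%N) (a1 a2 : R)
  (ha1 : 2 / m%:R < a1 <= 3 / m%:R) (ha2 : 2 / m%:R < a2 <= 3 / m%:R) :
  (forall F : 'rV[R[i]]_m.+1 -> 'rV[R[i]]_m.+1,
      biholomorphism (Dom m a1) (Dom m a2) F ->
      exists A : 'M[R[i]]_m.+1, forall z, Dom m a1 z -> F z = z *m A) /\
  ((exists F, biholomorphism (Dom m a1) (Dom m a2) F) ->
      linearly_equivalent (Dom m a1) (Dom m a2)).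
Proof.
have m0 : 0 <= (m%:R : R) := ler0n R m.
have a_gt0 (a : R) : 2 / m%:R < a <= 3 / m%:R -> 0 < a.
  by move=> /andP[+ _]; apply: le_lt_trans; rewrite divr_ge0.
have a10 := a_gt0 _ ha1; have a20 := a_gt0 _ ha2.
split=> [F FB|[F FB]].
  exact: (biholomorphic_linear hm a10 a20 FB).
exact: (biholomorphic_linearly_equivalent hm a10 a20 FB).
Qed.
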